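(* Let $F$ be a simple graph and let $k\geq 2$ be an even integer. Then there exists some $\varepsilon>0$ such that $\mathrm{ex}(n,F^{k-1})=O(n^{1+\frac{1}{k}-\varepsilon})$, where the implied constant may depend on $F$ and $k$ but not on $n$.
   Context: For a graph $F$ and an integer $m\geq 0$, the $m$-subdivision $F^{m}$ of $F$ is the graph obtained by replacing the edges of $F$ with pairwise internally vertex-disjoint paths of length $m+1$. For a graph $F'$, $\mathrm{ex}(n,F')$ denotes the maximum number of edges in an $n$-vertex graph not containing $F'$ as a subgraph. *)

(* Defs.v *)
From HB Require Import structures.
From mathcomp Require Import all_boot all_order all_algebra.

Set Implicit Arguments.
Unset Strict Implicit.
Unset Printing Implicit Defensive.

Record sgraph (V : finType) := SGraph {
  edges : {set {set V}};
  edgesP : [forall e in edges, #|e| == 2] }.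

HB.instance Definition _ (V : finType) := [isSub for @edges V].
HB.instance Definition _ (V : finType) := [Finite of sgraph V by <:].

Definition adj (V : finType) (G : sgraph V) (x y : V) : bool :=
  [set x; y] \in edges G.

(* Not necessarily induced. *)
Definition contains_copy (V W : finType) (G : sgraph V) (H : sgraph W) : bool :=
  [exists f : {ffun W -> V},
     injectiveb f && [forall x, forall y, adj H x y ==> adj G (f x) (f y)]].

(* The maximum of the empty family, reached when every graph on n vertices
   contains H (for instance H edgeless with at most n vertices), is 0. *)
Definition extremal_number (n : nat) (W : finType) (H : sgraph W) : nat :=
  \max_(G : sgraph 'I_n | ~~ contains_copy G H) #|edges G|.

Section Subdivision.
Variables (V : finType) (F : sgraph V) (m : nat).

(* Each edge of F taken once, oriented along the enumeration of V. *)
Definition oriented_edge : finType :=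
  {a : V * V | adj F a.1 a.2 && (enum_rank a.1 < enum_rank a.2)}.

Definition subdiv_vertex : finType := (V + oriented_edge * 'I_m)%type.

(* The path of length m.+1 replacing the edge a = (u, v): its point number 0
   is u, its points number 1, ..., m are the new vertices (a, 0), ...,
   (a, m - 1), and its point number m.+1 is v. *)
Definition subdiv_point (a : oriented_edge) (j : nat) : subdiv_vertex :=
  if j is i.+1 then
    if insub i is Some i' then inr (a, i') else inl (val a).2
  else inl (val a).1.

Definition subdiv_edges : {set {set subdiv_vertex}} :=
  [set [set subdiv_point a j; subdiv_point a j.+1] | a : oriented_edge, j : 'I_m.+1].

Lemma subdiv_edgesP : [forall e in subdiv_edges, #|e| == 2].
Proof.
apply/forall_inP => _ /imset2P[a j _ _ ->].
rewrite cards2; suff -> : subdiv_point a j != subdiv_point a j.+1 by [].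
rewrite /subdiv_point; case: j => -[|i] lt_im /=.
  case: insubP => [//|_].
  apply/eqP => -[eq_a]; have /andP[_] := valP a.
  by rewrite eq_a ltnn.
rewrite insubT; case: insubP => [k _ Dk|_ //].
apply/eqP => -[/(congr1 val)] /=; rewrite Dk => /n_Sn; exact.
Qed.

Definition subdivision : sgraph subdiv_vertex := SGraph subdiv_edgesP.

End Subdivision.

(* Main.v *)
(* Since F embeds in the complete graph on #|V| vertices, it suffices to find there a
   subdivided clique whose edges are paths of length k = 2l.

   A densest subgraph (number of edges over a power of the number of vertices) is almost
   regular up to a factor q, a small power of its order.  Call u, v linked at length j when
   no small set of vertices cuts all paths of length j between them; unlinked pairs are
   joined by few paths without linked subpaths.  A clique of pairs linked at length k
   greedily gives the subdivided clique, so assume that there is none.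
   - For j <= l few paths of length j have linked ends and no shorter linked subpath.
     Otherwise, by Kővári-Sós-Turán, some large set A of neighbours of a vertex is
     completely linked to a set B of almost D^(j-1) vertices, where D is the maximal
     degree.  If u is in A, then robustness of the links yields many vertices with many
     walks of length l mod j into B, and these are pairwise linked at length k by
     hopping between A and B.
   - In any large set W, join legs of length l from W to a common centre.  By Ramsey's
     theorem, among boundedly many legs some two have no vertices at equal distance from
     the centre that are linked at length k.  This also rules out nearly all links at lengths
     l + h: those would link the vertices at distance h from the centre.  So W contains
     many pairs joined by a path without linked subpaths, hence many joined pairs.
   - Therefore the branch vertices can be picked one by one inside shrinking sets W of
     pairwise joined candidates, discarding the few that create intersecting paths. *)
Require Import Defs.
From mathcomp Require Import all_boot zify.
From mathcomp Require boolp.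

Set Implicit Arguments.
Unset Strict Implicit.
Unset Printing Implicit Defensive.

(** * Walks *)

Section Walks.

Variables (T : finType) (e : rel T).
Implicit Types (x y u v : T) (p w s : seq T).

(** A walk is stored without its starting vertex, so that walks compose by concatenation; [allwalks]
    below keeps every vertex. *)
Fixpoint walks j x : seq (seq T) :=
  if j is j'.+1 then [seq y :: p | y <- enum (e x), p <- walks j' y]
  else [:: [::]].

Lemma mem_walks j x p : (p \in walks j x) = (size p == j) && path e x p.
Proof.
elim: j x p => [|j IHj] x p /=.
  by rewrite inE; case: p.
apply/allpairsPdep/idP => [[y [r [xy ry ->]]]|].
  move: ry; rewrite IHj => /andP[/eqP <- yr].
  by move: xy; rewrite mem_enum => xy; rewrite /= eqxx yr andbT; exact: xy.
case: p => [|y p] //= /andP[sp /andP[xy yp]].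
by exists y, p; rewrite mem_enum IHj yp -eqSS sp.
Qed.

Lemma walks_uniq j x : uniq (walks j x).
Proof.
elim: j x => [|j IHj] x //=.
apply: allpairs_uniq_dep => //; first exact: enum_uniq.
by move=> [y p] [z r] /= _ _ [-> ->].
Qed.

Lemma sum_walks0 x (F : seq T -> nat) : \sum_(p <- walks 0 x) F p = F [::].
Proof. by rewrite /= big_seq1. Qed.

Lemma sum_walksS j x (F : seq T -> nat) :
  \sum_(p <- walks j.+1 x) F p = \sum_(y | e x y) \sum_(p <- walks j y) F (y :: p).
Proof. by rewrite /= big_allpairs_dep big_enum. Qed.

Lemma sum_walksD i j x (F : seq T -> nat) :
  \sum_(p <- walks (i + j) x) F p =
  \sum_(p <- walks i x) \sum_(q <- walks j (last x p)) F (p ++ q).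
Proof.
elim: i x F => [|i IHi] x F; first by rewrite sum_walks0.
by rewrite addSn !sum_walksS; apply: eq_bigr => y _; rewrite IHi.
Qed.

Definition allwalks j : seq (seq T) := [seq x :: p | x <- enum T, p <- walks j x].

Lemma mem_allwalks j w : (w \in allwalks j) = (size w == j.+1) && sorted e w.
Proof.
apply/allpairsPdep/idP => [[x [p [_]]]|].
  by rewrite mem_walks => /andP[/eqP <- xp] ->; rewrite /= eqxx.
case: w => [|x p] //= /andP[sp xp].
by exists x, p; rewrite mem_enum mem_walks xp -eqSS sp.
Qed.

Lemma allwalks_uniq j : uniq (allwalks j).
Proof.
apply: allpairs_uniq_dep => [||[y p] [z r] /= _ _ [-> ->] //].
  exact: enum_uniq.
by move=> x _; apply: walks_uniq.
Qed.

Lemma sum_allwalks j (F : seq T -> nat) :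
  \sum_(w <- allwalks j) F w = \sum_x \sum_(p <- walks j x) F (x :: p).
Proof. by rewrite big_allpairs_dep big_enum. Qed.

Lemma sum_allwalks_catr x0 i j (F : seq T -> nat) :
  \sum_(w <- allwalks (i + j)) F w =
  \sum_(w <- allwalks i) \sum_(q <- walks j (last x0 w)) F (w ++ q).
Proof. by rewrite !sum_allwalks; apply: eq_bigr => x _; rewrite sum_walksD. Qed.

Hypothesis e_sym : symmetric e.

Lemma sorted_rev w : sorted e (rev w) = sorted e w.
Proof.
by rewrite rev_sorted; case: w => //= x p; apply: eq_path => y z; rewrite e_sym.
Qed.

Lemma sum_allwalks_rev j (F : seq T -> nat) :
  \sum_(w <- allwalks j) F w = \sum_(w <- allwalks j) F (rev w).
Proof.
rewrite -[RHS](big_map rev xpredT F); apply: perm_big; apply: uniq_perm.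
- exact: allwalks_uniq.
- by rewrite map_inj_uniq ?allwalks_uniq //; apply: can_inj revK.
move=> w; rewrite -[in RHS](revK w) mem_map; last exact: can_inj revK.
by rewrite !mem_allwalks size_rev sorted_rev.
Qed.

(** Symmetry of [e] lets the initial part be generated backwards from the first vertex of the rest,
    hence [rev q]. The default [x0] never shows, since members of [allwalks] are non-empty. *)
Lemma sum_allwalks_catl x0 i j (F : seq T -> nat) :
  \sum_(w <- allwalks (i + j)) F w =
  \sum_(w <- allwalks j) \sum_(q <- walks i (head x0 w)) F (rev q ++ w).
Proof.
rewrite sum_allwalks_rev addnC (sum_allwalks_catr x0) sum_allwalks_rev.
apply: eq_bigr => w _; have -> : last x0 (rev w) = head x0 w.
  by case: w => //= x p; rewrite rev_cons last_rcons.
by apply: eq_bigr => q _; rewrite rev_cat revK.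
Qed.

Variable D : nat.
Hypothesis degD : forall x, #|e x| <= D.

Lemma sum_walks_le c j x (F : seq T -> nat) :
  (forall p, p \in walks j x -> F p <= c) ->
  \sum_(p <- walks j x) F p <= c * D ^ j.
Proof.
elim: j x F => [|j IHj] x F leF.
  by rewrite sum_walks0 muln1 leF // mem_walks.
rewrite sum_walksS (@leq_trans (\sum_(y | e x y) c * D ^ j)) //.
  apply: leq_sum => y xy; apply: IHj => p; rewrite mem_walks => /andP[/eqP sp yp].
  by apply: leF; rewrite mem_walks /= sp eqxx xy.
by rewrite sum_nat_const expnS mulnCA !leq_mul.
Qed.

Lemma size_walks j x : size (walks j x) <= D ^ j.
Proof.
by rewrite -[D ^ j]mul1n -sum1_size; apply: sum_walks_le.
Qed.

(** The last step is forced, which saves one factor [D]. *)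
Lemma sum_walks_last j x y : \sum_(p <- walks j.+1 x) (last x p == y) <= D ^ j.
Proof.
rewrite -addn1 sum_walksD -[D ^ j]mul1n; apply: sum_walks_le => p _.
rewrite sum_walksS (@leq_trans (\sum_(z | e (last x p) z) (z == y))) //.
  by apply: leq_sum => z _; rewrite sum_walks0 last_cat.
rewrite -big_mkcondr /= sum1_card.
by rewrite (leq_trans (subset_leq_card (B := pred1 y) _)) ?card1 //; apply/subsetP => z /andP[].
Qed.

Lemma size_allwalks j : size (allwalks j) <= #|T| * D ^ j.
Proof.
rewrite -sum1_size sum_allwalks -sum_nat_const; apply: leq_sum => x _.
by rewrite sum1_size size_walks.
Qed.

(** Once the middle segment is fixed, each of the [a] steps before it and of the [b] steps after it
    has at most [D] choices. *)
Lemma sum_segment x0 a j b (P : pred (seq T)) :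
  \sum_(w <- allwalks (a + j + b)) P (take j.+1 (drop a w)) <=
  (\sum_(w <- allwalks j) P w) * D ^ (a + b).
Proof.
rewrite (sum_allwalks_catr x0) (sum_allwalks_catl x0) big_distrl /=.
rewrite big_seq [leqRHS]big_seq; apply: leq_sum => w.
rewrite mem_allwalks => /andP[/eqP sw _].
rewrite [a + b]addnC expnD mulnA; apply: sum_walks_le => q.
rewrite mem_walks => /andP[/eqP sq _].
apply: sum_walks_le => r _.
rewrite -catA drop_size_cat ?size_rev ?sq // take_cat sw ltnn subnn take0 cats0.
by case: (P w).
Qed.

End Walks.

(** * Linked pairs *)

Section Links.

Variables (T : finType) (e : rel T).
Hypothesis e_sym : symmetric e.
Implicit Types (x y u v : T) (p q w s : seq T).

(** Such a pair can be connected greedily as long as at most [r] other vertices have to be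
    avoided. *)
Definition linked r j u v :=
  [forall S : {set T}, [&& #|S| <= r, u \notin S & v \notin S] ==>
    has (fun p => [&& last u p == v, uniq (u :: p) & ~~ has [in S] p])
      (walks e j u)].

Lemma linkedP r j u v :
  reflect (forall s, size s <= r -> u \notin s -> v \notin s ->
             exists p, [/\ size p = j, path e u p, last u p = v, uniq (u :: p)
                         & ~~ has [in s] p])
          (linked r j u v).
Proof.
apply: (iffP forallP) => [lk s sr us vs|lk S].
  have := lk [set y in s]; rewrite !inE us vs !andbT cardsE.
  rewrite (leq_trans (card_size s) sr) /=.
  move=> /hasP[p]; rewrite mem_walks => /andP[/eqP sp up] /and3P[/eqP lp pU].
  move=> ns; exists p; split=> //.
  by apply: contra ns => /hasP[y yp ys]; apply/hasP; exists y; rewrite ?inE.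
apply/implyP => /and3P[Sr uS vS].
have [||| p [sp up lp pU ns]] := lk (enum S).
- by rewrite -cardE.
- by rewrite mem_enum.
- by rewrite mem_enum.
apply/hasP; exists p; first by rewrite mem_walks sp eqxx.
rewrite lp eqxx pU; apply: contra ns => /hasP[y yp yS].
by apply/hasP; exists y; rewrite ?mem_enum.
Qed.

Lemma linked_sym r j : symmetric (linked r j).
Proof.
suff lkC u v : linked r j u v -> linked r j v u by move=> u v; apply/idP/idP; apply: lkC.
move=> /linkedP lk; apply/linkedP => s sr vs us.
have [p [sp up lp pU ns]] := lk s sr us vs.
exists (rev (belast u p)); split.
- by rewrite size_rev size_belast.
- by rewrite -lp rev_path; apply: sub_path up => y z; rewrite e_sym.
- by rewrite -lp; case: (p) => // y p'; rewrite /= rev_cons last_rcons.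
- by rewrite -lp -rev_rcons -lastI rev_uniq.
rewrite has_rev; apply/hasPn => y /mem_belast; rewrite inE => /predU1P[->//|yp].
by move: ns => /hasPn/(_ y yp).
Qed.

(** As [p] omits its starting vertex, that vertex is put into [U] when a path is wanted. *)
Definition fresh (U p : seq T) := uniq p && ~~ has [in U] p.

Lemma fresh_cons (U : seq T) y p : fresh U (y :: p) = (y \notin U) && fresh (y :: U) p.
Proof.
rewrite /fresh /= negb_or andbACA [_ && (y \notin U)]andbC -andbA; congr (_ && _).
rewrite andbCA; congr (_ && _).
rewrite -negb_or; congr (~~ _).
elim: p => //= z p IHp; rewrite !inE -IHp eq_sym -!orbA; do !bool_congr.
Qed.

Variable D : nat.
Hypothesis degD : forall x, #|e x| <= D.

(** The step that spoils freshness lands in [U] or on an earlier vertex, so it has at most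
    [size U + a] choices instead of [D], and it is one of [a] steps. The factor [D] on the left
    replaces a division. *)
Lemma stale_walks (U : seq T) a x :
  D * (\sum_(p <- walks e a x) ~~ fresh U p) <= a * (size U + a) * D ^ a.
Proof.
elim: a x U => [|a IHa] x U; first by rewrite sum_walks0 muln0.
rewrite sum_walksS big_distrr /=.
pose b := a * ((size U).+1 + a) * D ^ a.
apply: (@leq_trans (\sum_(y | e x y) (D ^ a.+1 * (y \in U) + b))).
  apply: leq_sum => y _; under eq_bigr do rewrite fresh_cons negb_and negbK.
  have [yU|yU] := boolP (y \in U).
    rewrite muln1 (leq_trans _ (leq_addr _ _)) // expnS leq_mul2l -[D ^ a]mul1n.
    by rewrite sum_walks_le ?orbT // => p _; case: (_ || _).
  by rewrite /= muln0 add0n; apply: IHa.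
rewrite big_split /= -big_distrr sum_nat_const /=.
have cU : \sum_(y | e x y) (y \in U) <= size U.
  rewrite -big_mkcondr sum1_card (leq_trans _ (card_size U)) //.
  by apply: subset_leq_card; apply/subsetP => y /andP[].
have := degD x; rewrite /b !expnS.
set X := #|_|; move: cU; set Y := \sum_(_ | _) _ => YU XD.
move: (D ^ a) => E.
have -> : a.+1 * (size U + a.+1) * (D * E) =
  (D * E) * (size U) + D * ((a + a * (size U + a.+1) + 1) * E) by lia.
apply: leq_add; first by rewrite leq_mul2l YU orbT.
by apply: leq_mul => //; rewrite leq_mul2r; apply/orP; right; lia.
Qed.

(** The linked ends are connected by a path avoiding [s] and all vertices of the two walks but their
    last ones, hence the bound on sizes; this path is inserted between the walks. *)
Lemma glue_linked s r j x y p q :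
  size s + size p + size q <= r -> x != y -> x \notin s -> y \notin s ->
  path e x p -> path e y q -> fresh [:: x, y & s] p ->
  fresh (p ++ [:: x, y & s]) q -> linked r j (last x p) (last y q) ->
  exists w, [/\ size w = size p + j + size q, path e x w, last x w = y,
    uniq (x :: w) & ~~ has [in s] w].
Proof.
move=> sr xy xs ys xp yq /andP[pU pF] /andP[qU qF] /linkedP lk.
have pF' z : z \in p -> [/\ z != x, z != y & z \notin s].
  by move=> zp; have /hasPn/(_ z zp) := pF; rewrite !inE !negb_or => /and3P[].
have qF' z : z \in q -> [/\ z \notin p, z != x, z != y & z \notin s].
  move=> zq; have /hasPn/(_ z zq) := qF.
  by rewrite /= mem_cat !inE !negb_or => /and4P[].
have xpU : uniq (x :: p).
  by rewrite /= pU andbT; apply/negP => /pF'[]; rewrite eqxx.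
have yqU : uniq (y :: q).
  by rewrite /= qU andbT; apply/negP => /qF'[]; rewrite eqxx.
have disj z : z \in x :: p -> z \in y :: q -> False.
  rewrite !inE => /predU1P[->|zp] /predU1P[E|zq].
  - by rewrite E eqxx in xy.
  - by have [_] := qF' _ zq; rewrite eqxx.
  - by have [_] := pF' _ zp; rewrite E eqxx.
  - by have [] := qF' _ zq; rewrite zp.
have xpS z : z \in x :: p -> z \notin s by rewrite inE => /predU1P[->//|/pF'[]].
have yqS z : z \in y :: q -> z \notin s by rewrite inE => /predU1P[->//|/qF'[]].
have [|||z [sz xz lz zU zF]] := lk (s ++ belast x p ++ belast y q).
- by rewrite !size_cat !size_belast addnA.
- rewrite !mem_cat !negb_or xpS ?mem_last //=.
  move: xpU; rewrite lastI rcons_uniq => /andP[-> _] /=.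
  by apply/negP => /mem_belast; apply: disj; rewrite mem_last.
- rewrite !mem_cat !negb_or yqS ?mem_last //=.
  move: yqU; rewrite lastI rcons_uniq => /andP[-> _] /=; rewrite andbT.
  by apply/negP => /mem_belast lp; apply: disj lp _; rewrite mem_last.
have zF' t : t \in z -> [/\ t \notin s, t \notin belast x p & t \notin belast y q].
  by move=> tz; have /hasPn/(_ t tz) := zF; rewrite /= !mem_cat !negb_or => /and3P[].
exists (p ++ z ++ rev (belast y q)); split.
- by rewrite !size_cat size_rev size_belast sz addnA.
- rewrite !cat_path xp xz lz rev_path /=.
  by apply: sub_path yq => t t'; rewrite e_sym.
- rewrite !last_cat lz; case: (q) => //= t q'.
  by rewrite rev_cons last_rcons.
- rewrite -cat_cons lastI cat_rcons -cat_cons catA cat_uniq cat_uniq zU rev_uniq.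
  move: xpU yqU; rewrite (lastI x p) (lastI y q) !rcons_uniq.
  move=> /andP[lxp ->] /andP[_ ->].
  rewrite !andbT /= negb_or lxp /=; apply/andP; split.
    by apply/hasPn => t /zF'[].
  apply/hasPn => t; rewrite /= mem_rev => tq; rewrite mem_cat inE !negb_or.
  apply/and3P; split.
  + by apply/negP => /mem_belast tp; apply: (disj t) => //; apply: mem_belast tq.
  + apply/eqP => tE; apply: (disj t); last exact: mem_belast tq.
    by rewrite tE mem_last.
  + by apply/negP => /zF'[_ _]; rewrite tq.
apply/hasPn => t; rewrite !mem_cat mem_rev => /or3P[/pF'[]//|/zF'[]//|tq].
exact: yqS (mem_belast tq).
Qed.

(* Avoiding a cut of size C between x and y, two fresh walks with linked ends would
   be completed to a path of length k by [glue_linked]. *)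
Lemma unlinked_extensions C r a b j k x y :
  a + j + b = k -> C + a + b <= r -> x != y -> ~~ linked C k x y ->
  D * (\sum_(p <- walks e a x) \sum_(q <- walks e b y)
         linked r j (last x p) (last y q)) <=
  (a * (C.+2 + a) + b * (C.+2 + a + b)) * D ^ (a + b).
Proof.
move=> abk Cr xy nlk.
have [s [sC xs ys nop]] : exists s, [/\ size s <= C, x \notin s, y \notin s &
    forall p, size p = k -> path e x p -> last x p = y -> uniq (x :: p) ->
      has [in s] p].
  have [S] := forallPn nlk; rewrite negb_imply => /andP[/and3P[SC xS yS] nS].
  exists (enum S); rewrite -cardE !mem_enum; split=> // p sp xp lp pU.
  move: nS; apply: contraR => ns; apply/hasP; exists p.
    by rewrite mem_walks sp eqxx.
  rewrite lp eqxx pU; apply: contra ns => /hasP[z zp zS].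
  by apply/hasP; exists z; rewrite ?mem_enum.
pose U := [:: x, y & s].
have key p q : p \in walks e a x -> q \in walks e b y ->
    linked r j (last x p) (last y q) <= ~~ fresh U p + ~~ fresh (p ++ U) q.
  rewrite !mem_walks => /andP[/eqP sp xp] /andP[/eqP sq yq].
  have [pF|] := boolP (fresh U p); last by case: linked.
  have [qF|] := boolP (fresh (p ++ U) q); last by case: linked.
  rewrite leqn0 eqb0; apply/negP => lk.
  have sr : size s + size p + size q <= r.
    by rewrite sp sq (leq_trans _ Cr) // !leq_add2r.
  have [w [sw xw lw wU /negP[]]] := glue_linked sr xy xs ys xp yq pF qF lk.
  by apply: nop; rewrite // sw sp sq.
(* By [key], a linked pair of ends is charged to a stale [p] with [q] arbitrary, or to a [q] that is
   stale with respect to [p]. *)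
apply: (@leq_trans (D * (\sum_(p <- walks e a x) (~~ fresh U p) * D ^ b) +
   \sum_(p <- walks e a x) b * (C.+2 + a + b) * D ^ b)).
  rewrite !big_distrr -big_split /= big_seq [leqRHS]big_seq.
  apply: leq_sum => p pw.
  apply: (@leq_trans (\sum_(q <- walks e b y) D * (~~ fresh U p + ~~ fresh (p ++ U) q))).
    rewrite big_distrr big_seq [leqRHS]big_seq /=; apply: leq_sum => q qw.
    by rewrite leq_mul2l key ?orbT.
  rewrite -big_distrr big_split [X in X <= _]mulnDr /=; apply: leq_add.
    by rewrite leq_mul2l sum_walks_le ?orbT.
  have := stale_walks (p ++ U) b y.
  move=> /leq_trans -> //; rewrite leq_mul2r leq_mul2l leq_add2r.
  move: pw; rewrite mem_walks => /andP[/eqP sp _].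
  by rewrite size_cat /= sp addnC leq_add2r !ltnS sC !orbT.
rewrite -big_distrl mulnA expnD mulnDl; apply: leq_add.
  rewrite mulnA leq_mul2r (leq_trans (stale_walks _ _ _)) ?orbT //.
  by rewrite leq_mul2r leq_mul2l leq_add2r !ltnS sC !orbT.
rewrite mulnCA [leqRHS]mulnC; exact: sum_walks_le.
Qed.

Variables (x0 : T) (r : nat -> nat).

(** The lengths run from 2 to [m]: an edge between distinct vertices links them at length 1 for
    every robustness. *)
Definition nolink m w :=
  all (fun j => all (fun i => ~~ linked (r j) j (nth x0 w i) (nth x0 w (i + j)))
         (iota 0 (size w - j))) (iota 2 m.-1).

Lemma nolinkP m w :
  reflect (forall j i, 2 <= j <= m -> i + j < size w ->
             ~~ linked (r j) j (nth x0 w i) (nth x0 w (i + j)))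
          (nolink m w).
Proof.
apply: (iffP allP) => [nl j i jm ij|nl j].
  have /allP nlj : all (fun i => ~~ linked (r j) j (nth x0 w i) (nth x0 w (i + j)))
    (iota 0 (size w - j)) by apply: nl; rewrite mem_iota; lia.
  by apply: nlj; rewrite mem_iota; lia.
rewrite mem_iota => jm; apply/allP => i; rewrite mem_iota => ij.
by apply: nl; lia.
Qed.

Lemma nolink_catl m p q : nolink m (p ++ q) -> nolink m p.
Proof.
move=> /nolinkP nl; apply/nolinkP => j i jm ij.
have := nl j i jm; rewrite size_cat !nth_cat ij ltn_addr //.
by rewrite (leq_ltn_trans _ ij) ?leq_addr //; apply.
Qed.

Lemma nolink_catr m p q : nolink m (p ++ q) -> nolink m q.
Proof.
move=> /nolinkP nl; apply/nolinkP => j i jm ij.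
have := nl j (size p + i) jm; rewrite size_cat !nth_cat -addnA ltn_add2l.
rewrite !ltnNge !leq_addr /= !addKn; apply.
by rewrite -ltnNge.
Qed.

Definition good m u p := uniq (u :: p) && nolink m (u :: p).

(* An unlinked pair (u, v) has a small cut, through which every good walk from
   u to v passes; recursion on the two parts gives the bound. *)
Lemma good_walks m rho j u v :
  (forall i, i <= m -> r i <= rho) -> 0 < j <= m ->
  \sum_(p <- walks e j u) ((last u p == v) && good m u p) <= (m * rho) ^ j.-1.
Proof.
move=> rle; have [n] := ubnP j; elim: n j u v => // n IHn j u v jn jm.
have [j1|j2] := leqP j 1.
  have -> : j = 1 by lia.
  rewrite expn0 (leq_trans _ (sum_walks_last degD 0 u v)) //.
  by apply: leq_sum => p _; case: (_ == _) => //=; case: good.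
have [/hasP[p0]|/hasPn none] :=
  boolP (has (fun p => (last u p == v) && good m u p) (walks e j u)); last first.
  by rewrite big_seq big1 // => p /none/negbTE ->.
rewrite mem_walks => /andP[/eqP sp0 _] /andP[/eqP lp0 /andP[_ /nolinkP]].
move=> /(_ j 0) /= ; rewrite sp0 add0n => /(_ _ (ltnSn j)) nl.
have {nl} : ~~ linked (r j) j u v.
  rewrite -lp0 (last_nth x0) sp0; apply: nl; lia.
move=> /forallPn[S]; rewrite negb_imply => /andP[/and3P[Sr uS vS] nS].
(* Each good walk is charged to a vertex [y] of the cut [S] lying on it and to the position [i] of
   [y], which is internal because [S] avoids [u] and [v]. *)
apply: (@leq_trans (\sum_(y in S) \sum_(1 <= i < j) \sum_(p <- walks e j u)
    ((last u p == v) && good m u p) * (nth x0 (u :: p) i == y))).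
  under [leqRHS]eq_bigr => y _ do rewrite exchange_big.
  rewrite exchange_big big_seq [leqRHS]big_seq /=; apply: leq_sum => p pw.
  have [/andP[/eqP lp gp]|//] := boolP (_ && _).
  have : has [in S] p.
    move: nS; apply: contraR => npS; apply/hasP; exists p => //.
    by rewrite lp eqxx npS andbT; case/andP: gp.
  move=> /hasP[y yp] /= yS.
  rewrite (bigD1 y) //= ltn_addr //.
  move: pw; rewrite mem_walks => /andP[/eqP sp _].
  have ij : index y p < j.-1.
    have : index y p < size p by rewrite index_mem.
    have : index y p != j.-1.
      apply/eqP => E; move: vS; rewrite -lp (last_nth y) sp.
      by rewrite -[j]prednK ?(ltnW j2) //= -E nth_index ?yS.
    by rewrite sp; lia.
  rewrite (big_cat_nat (n := (index y p).+1)) //=; last by lia.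
  rewrite [X in _ + X]big_ltn; last by lia.
  by rewrite /= nth_index // eqxx muln1; lia.
rewrite -[j.-1]prednK ?expnS; last by lia.
apply: (@leq_trans (\sum_(y in S) \sum_(1 <= i < j) (m * rho) ^ j.-2)); last first.
  rewrite !sum_nat_const sum_nat_const_nat mulnA leq_mul2r.
  apply/orP; right; rewrite mulnC; apply: leq_mul; first by lia.
  by apply: leq_trans Sr (rle _ _); lia.
apply: leq_sum => y _; rewrite big_nat [leqRHS]big_nat; apply: leq_sum => i ij.
have -> : walks e j u = walks e (i + (j - i)) u by congr walks; lia.
rewrite sum_walksD.
have -> : j.-2 = i.-1 + (j - i).-1 by lia.
rewrite expnD.
apply: (@leq_trans (\sum_(p <- walks e i u) ((last u p == y) && good m u p) *
    (m * rho) ^ (j - i).-1)); last first.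
  by rewrite -big_distrl /= leq_mul2r IHn ?orbT //; lia.
rewrite big_seq [leqRHS]big_seq; apply: leq_sum => p.
rewrite mem_walks => /andP[/eqP sp _].
have nthp q : nth x0 (u :: p ++ q) i = last u p.
  by rewrite (last_nth x0) sp -cat_cons nth_cat /= sp ltnSn.
have [/andP[/eqP ly gp]|ng] := boolP (_ && _); last first.
  rewrite big1_seq // => q _; rewrite nthp.
  apply/eqP; rewrite muln_eq0 !eqb0 -negb_and; apply: contra ng => /andP[].
  move=> /andP[_ /andP[]]; rewrite -cat_cons cat_uniq => /and3P[up _ _].
  by move=> /nolink_catl nl ->; rewrite /good up nl.
rewrite mul1n (leq_trans _ (IHn (j - i) (last u p) v _ _)) //; last 2 first.
- by lia.
- by lia.
apply: leq_sum => q _; rewrite nthp ly eqxx muln1 last_cat ly.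
case: (last y q == v) => //=.
have [/andP[]|//] := boolP (good m u (p ++ q)).
rewrite -ly -cat_cons lastI cat_rcons => /[dup]; rewrite cat_uniq => /and3P[_ _ qU] _.
by move=> /nolink_catr nl; rewrite /good qU nl.
Qed.

(** A link without shorter links inside: the part of length [j.-1] left after dropping the first
    vertex is a good walk, and [good_walks] counts those. *)
Definition admissible j w :=
  [&& uniq w, nolink j.-1 w & linked (r j) j (head x0 w) (last x0 w)].

(** Among the linked pairs along [w], one of minimal length [j] bounds a segment without shorter
    links. *)
Lemma first_link m w : size w = m.+1 -> uniq w -> ~~ nolink m w ->
  exists j i, [/\ 2 <= j, i + j <= m & admissible j (take j.+1 (drop i w))].
Proof.
move=> sw wU nl.
pose P j := [exists i : 'I_m, (2 <= j <= m) && (i + j < size w) &&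
  linked (r j) j (nth x0 w i) (nth x0 w (i + j))].
have exP : exists j, P j.
  move: nl => /allPn[j]; rewrite mem_iota => jm /allPn[i]; rewrite mem_iota negbK.
  move=> ij lk; have im : i < m by lia.
  exists j; apply/existsP; exists (Ordinal im) => /=; rewrite lk andbT; lia.
have := ex_minnP exP => -[j /existsP[i /andP[/andP[jm ij] lk]] jmin].
exists j, (i : nat); split; [lia | lia |].
have sj : size (take j.+1 (drop i w)) = j.+1.
  by rewrite size_takel // size_drop; lia.
have ntht n : n <= j -> nth x0 (take j.+1 (drop i w)) n = nth x0 w (i + n).
  by move=> nj; rewrite nth_take // nth_drop.
apply/and3P; split; first by rewrite take_uniq // drop_uniq.
  apply/nolinkP => j' i' j'm; rewrite sj => ij'; rewrite !ntht; [|lia|lia].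
  apply/negP => lk'; have : j <= j'; last by lia.
  apply: jmin; apply/existsP.
  have im : i + i' < m by lia.
  exists (Ordinal im) => /=; rewrite -addnA lk' andbT; lia.
by rewrite -nth0 -nth_last sj /= !ntht // addn0.
Qed.

End Links.

(** * Short links *)

Lemma fresh_elt (T : finType) (A : {set T}) (s : seq T) :
  size s < #|A| -> exists2 a, a \in A & a \notin s.
Proof.
move=> sA; have [/subsetP AS|/subsetPn[a aA aS]] := boolP (A \subset s).
  have := subset_leq_card (introT subsetP AS).
  by move=> /leq_trans/(_ (card_size s)); rewrite leqNgt sA.
by exists a.
Qed.

(** Greedy argument. At least [n / (2 * Q)] elements of [V] have degree at least [D / (2 * Q)].
    Elements of [X] then join [A] one by one, each related to a fraction [1 / (4 * Q)] of the common
    neighbours so far. *)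
Lemma kovari_sos_turan (T : finType) (X V : {set T}) (P : rel T) D n Q M :
  #|X| <= D -> #|V| <= n -> 0 < D -> 0 < n -> 4 * Q * M <= D ->
  D * n <= Q * \sum_(b in V) #|[set a in X | P a b]| ->
  exists A : {set T}, [/\ A \subset X, #|A| = M &
    n <= 2 * Q * (4 * Q) ^ M * #|[set b in V | [forall a in A, P a b]]|].
Proof.
move=> XD Vn D0 n0 QMD dense.
pose d b := #|[set a in X | P a b]|.
pose V0 := [set b in V | D <= 2 * Q * d b].
have dD b : d b <= D.
  by apply: leq_trans XD; apply: subset_leq_card; apply/subsetP => a; rewrite inE => /andP[].
have nV0 : n <= 2 * Q * #|V0|.
  have : 2 * Q * (\sum_(b in V) d b) <= \sum_(b in V) ((b \in V0) * (2 * Q * D) + D).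
    rewrite big_distrr; apply: leq_sum => b bV; rewrite inE bV /=.
    have [_|/ltnW le] := leqP D (2 * Q * d b); last by rewrite (leq_trans le) // leq_addl.
    by rewrite mul1n (leq_trans _ (leq_addr _ _)) // leq_mul2l dD orbT.
  rewrite big_split sum_nat_const /= -big_distrl /=.
  have -> : \sum_(b in V) (b \in V0) = #|V0|.
    rewrite -big_mkcondr sum1dep_card; apply: eq_card => b; rewrite !inE /=.
    by case: (b \in V).
  move: dense Vn; rewrite /d; move: (\sum_(b in V) _) => S dn Vn.
  move: (#|V0|) (#|V|) Vn D0 n0 dn => v0 v Vn D0 n0 dn le.
  have {Vn} vD : v * D <= n * D by rewrite leq_mul2r Vn orbT.
  rewrite -(leq_pmul2l D0); move: dn le; rewrite -!mulnA !(mulnCA _ 2) [D * n]mulnC.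
  rewrite [D * (Q * v0)]mulnC -!mulnA [v0 * (Q * D)]mulnCA.
  move: vD; move: (v * D) (n * D) (Q * S) (Q * (v0 * D)) => a1 a2 a3 a4; clear; lia.
have claim m : m <= M -> exists A : {set T}, [/\ A \subset X, #|A| = m &
    n <= 2 * Q * (4 * Q) ^ m * #|[set b in V0 | [forall a in A, P a b]]|].
  elim: m => [_|m IHm mM].
    exists set0; rewrite sub0set cards0 muln1; split=> //.
    rewrite (leq_trans nV0) // leq_mul2l subset_leq_card ?orbT //.
    apply/subsetP => b bV; rewrite inE bV; apply/forall_inP => a; by rewrite inE.
  have [A [AX Am nB]] := IHm (ltnW mM); set B := [set b in V0 | _] in nB.
  have B0 : 0 < #|B| by move: nB; case: (#|B|) => //; rewrite muln0 leqNgt n0.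
  (* Only [m] neighbours can lie in [A], and [4 * Q * M <= D], so at least half of the degree
     [D / (2 * Q)] remains outside [A]. *)
  have manyA b : b \in B -> D <= 4 * Q * #|[set a in X :\: A | P a b]|.
    rewrite !inE => /andP[/andP[_ bD] _].
    have : d b <= #|[set a in X :\: A | P a b]| + m.
      rewrite -Am -cardsUI (leq_trans _ (leq_addr _ _)) //; apply: subset_leq_card.
      apply/subsetP => a; rewrite !inE => /andP[-> ->]; rewrite !andbT.
      by case: (a \in A).
    move: QMD mM bD; move: (d b) => db; move: #|_| => z QMD mM bD dz.
    have : 2 * Q * db <= 2 * Q * (z + m) by rewrite leq_mul2l dz orbT.
    have : 4 * Q * m <= 4 * Q * M by rewrite leq_mul2l (ltnW mM) orbT.
    move: QMD bD; rewrite mulnDr -!mulnA.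
    move: (Q * M) (Q * db) (Q * z) (Q * m) => a1 a2 a3 a4; clear; lia.
  (* If no element outside [A] kept this fraction of [B], counting the pairs from the side of [X]
     would contradict the count [le1] from the side of [B]. *)
  have [/exists_inP[a]|/exists_inPn noa] :=
    boolP [exists a in X :\: A, #|B| <= 4 * Q * #|[set b in B | P a b]|].
    rewrite inE => /andP[aA aX] le; exists (a |: A); split.
    - by rewrite subUset sub1set aX.
    - by rewrite cardsU1 aA Am.
    rewrite (leq_trans nB) // expnSr mulnA -[leqRHS]mulnA leq_mul2l.
    rewrite (leq_trans le) ?orbT // leq_mul2l subset_leq_card ?orbT //.
    apply/subsetP => b; rewrite !inE => /andP[/andP[-> /forall_inP Ab] ab] /=.
    by apply/forall_inP => a'; rewrite !inE => /predU1P[->//|]; apply: Ab.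
  have le1 : #|B| * D <= 4 * Q * \sum_(a in X :\: A) #|[set b in B | P a b]|.
    rewrite -sum_nat_const (leq_trans (leq_sum _ manyA)) //.
    rewrite -big_distrr leq_mul2l /=; apply/orP; right.
    under eq_bigr do rewrite -sum1dep_card big_mkcondr.
    under [leqRHS]eq_bigr do rewrite -sum1dep_card big_mkcondr.
    by rewrite exchange_big.
  have [a0 a0X] : exists a, a \in X :\: A.
    apply/set0Pn; apply/eqP => E; move: le1; rewrite E big_set0 muln0.
    by rewrite leqNgt muln_gt0 B0 D0.
  have : 4 * Q * \sum_(a in X :\: A) #|[set b in B | P a b]| < #|B| * D.
    apply: (@leq_trans (#|X :\: A| * #|B|)); last first.
      by rewrite mulnC leq_mul2l (leq_trans _ XD) ?orbT // subset_leq_card ?subsetDl.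
    apply: (@leq_trans (\sum_(a in X :\: A) (4 * Q * #|[set b in B | P a b]|).+1)).
      under [leqRHS]eq_bigr do rewrite -addn1.
      rewrite big_split sum1_card big_distrr /= -[leqLHS]addn1 leq_add2l.
      by apply/card_gt0P; exists a0.
    rewrite -sum_nat_const leq_sum // => a aX.
    by rewrite ltnNge noa.
  by rewrite ltnNge le1.
have [A [AX AM nB]] := claim M (leqnn M).
exists A; split=> //; rewrite (leq_trans nB) // leq_mul2l subset_leq_card ?orbT //.
by apply/subsetP => b; rewrite !inE => /andP[/andP[-> _] ->].
Qed.

(* [size s] may occur under convertible but distinct carriers, which [lia]
   would treat as different atoms. *)
Ltac slia :=
  repeat match goal with
  | H : is_true (uniq _) |- _ => clear H
  | H : is_true (path _ _ _) |- _ => clear H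
  | H : is_true (_ \in _) |- _ => clear H
  | H : is_true (~~ _) |- _ => clear H
  | H : is_true (fresh _ _) |- _ => clear H
  | H : is_true (_ < _ * _) |- _ => clear H
  | H : forall _, _ |- _ => clear H
  end;
  match goal with T : Finite.type |- _ =>
    change (Equality.sort T) with (Finite.sort T) in *
  end; lia.

Section ShortLinks.

Variables (T : finType) (e : rel T).
Hypotheses (e_sym : symmetric e) (e_irr : irreflexive e).

(** * Hopping between two completely linked sets *)

Section Hops.

Variables (A B : {set T}) (r j : nat).
Hypothesis j_gt0 : 0 < j.
Hypothesis AB : forall a b, a \in A -> b \in B -> linked e r j a b.

(** Some [a] in [A] is not excluded. The path from [b] to [a] is made to avoid [b'], and the path
    from [a] to [b'] is made to avoid the first one. *)
Lemma hop s b b' : size s + 2 * j + 3 <= r -> size s + 2 < #|A| ->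
  b \in B -> b' \in B -> b != b' -> b \notin s -> b' \notin s ->
  exists p, [/\ size p = 2 * j, path e b p, last b p = b', uniq (b :: p)
    & ~~ has [in s] p].
Proof.
move=> sr sA bB b'B bb' bs b's.
have [|a aA] := @fresh_elt _ A [:: b, b' & s]; first by rewrite /= -addn2.
rewrite !inE !negb_or => /and3P[ab ab' as_].
have := AB aA bB; rewrite linked_sym // => /linkedP/(_ (b' :: s))[].
- by rewrite /=; slia.
- by rewrite inE negb_or bb'.
- by rewrite inE negb_or ab'.
move=> p [sp bp lp pU /hasPn ps].
have := AB aA b'B => /linkedP/(_ (belast b p ++ s))[].
- by rewrite size_cat size_belast; slia.
- by rewrite mem_cat negb_or as_ andbT -lp; move: pU; rewrite lastI rcons_uniq => /andP[].
- rewrite mem_cat negb_or b's andbT; apply/negP => /mem_belast.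
  by rewrite inE eq_sym (negbTE bb') => /ps /=; rewrite inE eqxx.
move=> q [sq aq lq qU /hasPn qs].
exists (p ++ q); split.
- by rewrite size_cat sp sq; slia.
- by rewrite cat_path bp lp.
- by rewrite last_cat lp.
- rewrite -cat_cons lastI cat_rcons cat_uniq lp qU andbT.
  move: pU; rewrite lastI rcons_uniq lp => /andP[ap ->] /=.
  rewrite negb_or ap; apply/hasPn => z /qs /=; rewrite mem_cat negb_or.
  by case/andP.
apply/hasPn => z; rewrite mem_cat => /orP[/ps|/qs] /=.
  by rewrite inE negb_or => /andP[].
by rewrite mem_cat negb_or => /andP[].
Qed.

(** Each hop adds [2 * j] vertices to be avoided by the remaining ones; hence [r'] varies in the
    induction on [m]. *)
Lemma hops r' m b b' : 0 < m ->
  r' + m * (2 * j) + 3 <= r -> r' + m * (2 * j) + 3 <= #|A| ->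
  r' + m * (2 * j) + 3 <= #|B| -> b \in B -> b' \in B -> b != b' ->
  linked e r' (m * (2 * j)) b b'.
Proof.
case: m => // m _; elim: m r' b => [|m IHm] r' b Kr KA KB bB b'B bb'.
  apply/linkedP => s sr bs b's; rewrite mul1n; apply: hop => //; slia.
apply/linkedP => s sr bs b's.
have [|c cB] := @fresh_elt _ B [:: b, b' & s]; first by rewrite /=; slia.
rewrite !inE !negb_or => /and3P[cb cb' cs].
have [|||||p [sp bp lp pU /hasPn ps]] := @hop (b' :: s) b c _ _ bB cB _ _ _.
- by rewrite /=; slia.
- by rewrite /=; slia.
- by rewrite eq_sym.
- by rewrite inE negb_or bb'.
- by rewrite inE negb_or cb'.
have /linkedP/(_ (belast b p ++ s))[] : linked e (r' + 2 * j) (m.+1 * (2 * j)) c b'.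
  apply: IHm => //; slia.
- by rewrite size_cat size_belast sp; slia.
- by rewrite mem_cat negb_or cs andbT -lp; move: pU; rewrite lastI rcons_uniq => /andP[].
- rewrite mem_cat negb_or b's andbT; apply/negP => /mem_belast.
  by rewrite inE eq_sym (negbTE bb') => /ps /=; rewrite inE eqxx.
move=> q [sq cq lq qU /hasPn qs].
exists (p ++ q); split.
- by rewrite size_cat sp sq; slia.
- by rewrite cat_path bp lp.
- by rewrite last_cat lp.
- rewrite -cat_cons lastI cat_rcons cat_uniq lp qU andbT.
  move: pU; rewrite lastI rcons_uniq lp => /andP[cp ->] /=.
  rewrite negb_or cp; apply/hasPn => z /qs /=; rewrite mem_cat negb_or.
  by case/andP.
apply/hasPn => z; rewrite mem_cat => /orP[/ps|/qs] /=.
  by rewrite inE negb_or => /andP[].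
by rewrite mem_cat negb_or => /andP[].
Qed.

End Hops.

Variable D : nat.
Hypothesis degD : forall x, #|e x| <= D.

(** By [stale_walks], the stale walks are too few to be all the walks into [B]. *)
Lemma rich_walk (B : {set T}) (U : seq T) c a x : a * (size U + a) <= c ->
  c * D ^ a < D * \sum_(p <- walks e a x) (last x p \in B) ->
  exists p, [/\ p \in walks e a x, last x p \in B & fresh U p].
Proof.
move=> cle rich.
have [/hasP[p pw /andP[pB pU]]|/hasPn none] :=
  boolP (has (fun p => (last x p \in B) && fresh U p) (walks e a x)).
  by exists p.
have : D * \sum_(p <- walks e a x) (last x p \in B) <=
    D * \sum_(p <- walks e a x) ~~ fresh U p.
  rewrite leq_mul2l big_seq [leqRHS]big_seq leq_sum ?orbT // => p /none.
  by case: (_ \in B); case: fresh.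
move=> /leq_trans/(_ (stale_walks degD U a x)).
move=> /(leq_trans rich); rewrite ltnNge leq_mul2r cle orbT //.
Qed.

(** Fresh walks of length [p] lead from [x] and from [y] into [B], and [m] hops connect their
    ends. *)
Lemma rich_linked (A B : {set T}) C r j p m c x y :
  0 < j -> 0 < m ->
  (forall a b, a \in A -> b \in B -> linked e r j a b) ->
  C + (p + m * (2 * j) + p) + 3 <= r -> C + (p + m * (2 * j) + p) + 3 <= #|A| ->
  C + (p + m * (2 * j) + p) + 3 <= #|B| ->
  p * (C.+2 + (p + p)) <= c ->
  c * D ^ p < D * \sum_(w <- walks e p x) (last x w \in B) ->
  c * D ^ p < D * \sum_(w <- walks e p y) (last y w \in B) ->
  x != y -> linked e C (p + m * (2 * j) + p) x y.
Proof.
move=> j0 m0 AB Kr KA KB cle xr yr xy; apply/linkedP => s sC xs ys.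
have [|w [ww wB wU]] := @rich_walk B [:: x, y & s] c p x _ xr.
  by rewrite (leq_trans _ cle) // leq_mul2l /=; apply/orP; right; slia.
move: ww; rewrite mem_walks => /andP[/eqP sw xw].
have [|z [zw zB zU]] := @rich_walk B (w ++ [:: x, y & s]) c p y _ yr.
  by rewrite (leq_trans _ cle) // leq_mul2l size_cat /=; apply/orP; right; slia.
move: zw; rewrite mem_walks => /andP[/eqP sz yz].
(* [z] is fresh for [w], [x] and [y]; the cases of empty walks arise when [p = 0]. *)
have lxy : last x w != last y z.
  case/andP: zU => _ /hasPn zF; case: (lastP z) zF => [_|z' t /(_ t)] /=.
    case/andP: wU => _ /hasPn; case: (lastP w) => [_|w' t /(_ t)] //=.
    rewrite mem_rcons inE eqxx last_rcons !inE !negb_or => /(_ isT) /and3P[_ + _].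
    by [].
  rewrite mem_rcons inE eqxx last_rcons mem_cat !inE !negb_or.
  move=> /(_ isT) /and4P[tw tx _ _]; have := mem_last x w; rewrite inE.
  by move=> /predU1P[->|lw]; [rewrite eq_sym|apply: contraNneq tw => <-].
have lk : linked e (C + p + p) (m * (2 * j)) (last x w) (last y z).
  by apply: (@hops A B r j) => //; slia.
have sr : size s + size w + size z <= C + p + p by slia.
have [v [sv xv lv vU vs]] := glue_linked e_sym sr xy xs ys xw yz wU zU lk.
by exists v; rewrite sv sw sz.
Qed.

Variables (x0 : T) (r : nat -> nat).

(** The first steps of the paths from [u] to [b] form a cut, so there are more than [r j] of them,
    and they begin different walks. As [2 <= j], no such path starts with [b], which may thus be
    left out of the cut. *)
Lemma first_steps j u b : 2 <= j -> linked e (r j) j u b ->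
  r j <= \sum_(p <- walks e j u) (last u p == b).
Proof.
case: j => // j j1 lk.
pose Y := [set y | e u y && has (fun p => last y p == b) (walks e j y)].
have rY : r j.+1 < #|Y :\ b|.
  rewrite ltnNge; apply/negP => Yr; move/linkedP: lk => /(_ (enum (Y :\ b)))[].
  - by rewrite -cardE.
  - by rewrite mem_enum !inE e_irr andbF.
  - by rewrite mem_enum !inE eqxx.
  move=> [|y p] [] //= [sp] /andP[uy yp] lp /and3P[_ ypU _].
  rewrite mem_enum !inE uy negb_or => /andP[/negP yY _]; apply: yY.
  apply/and3P; split=> //; last first.
    by apply/hasP; exists p; rewrite ?lp // mem_walks sp eqxx.
  case: p sp lp ypU {yp} => [s0|z p _ <-]; first by rewrite -s0 in j1.
  by apply: contraNneq => {1}->; rewrite /= mem_last.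
rewrite (leq_trans (ltnW rY)) // (leq_trans (subset_leq_card (subsetDl _ _))) //.
rewrite sum_walksS -sum1_card [leqLHS]big_mkcond [leqRHS]big_mkcond leq_sum // => y _.
rewrite inE; case: (e u y) => //=; case: hasP => // -[p pw lp].
by rewrite (bigD1_seq p) ?walks_uniq //= lp.
Qed.

(** Fix a vertex [x] that is second on many admissible walks. Since [good_walks] bounds the walks
    from [x] to a given [b], many pairs of a first vertex [a] and a last vertex [b] are linked, and
    this yields [A] and [B]. From [u] in [A] at least [#|B| * r j] walks of length [j] end in [B],
    which forces [t] rich vertices [p] steps before the end; [rich_linked] applies to these. *)
Lemma dense_short_links C t Qd rho j m p M :
  let k := p + m * (2 * j) + p in
  let Q := Qd * (j.-1 * rho) ^ j.-2 in
  2 <= j -> p < j -> 0 < m -> (forall i, i < j -> r i <= rho) ->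
  4 * Q * M <= D -> 2 * Q * (4 * Q) ^ M * (C + k + 3) <= D ->
  2 * Q * (4 * Q) ^ M * (t + k * (C.+2 + k)) < r j ->
  C + k + 3 <= M -> C + k + 3 <= r j ->
  #|T| * D ^ j < Qd * \sum_(w <- allwalks e j) admissible e x0 r j w ->
  exists s, [/\ size s = t, uniq s
    & {in s &, forall x y, x != y -> linked e C k x y}].
Proof.
move=> k Q j2 pj m0 rle QMD QD Qr KM Kr dense.
pose L a b := linked e (r j) j a b.
(* Admissible walks are sorted by their second vertex. *)
pose S x := \sum_(p <- walks e j.-1 x) \sum_(a | e x a) admissible e x0 r j [:: a, x & p].
have [x Sx] : exists x, D ^ j < Qd * S x.
  apply/existsP; apply: contraLR dense => /existsPn noS.
  rewrite -leqNgt -{1}[j]prednK ?(ltnW j2) // -[j.-1.+1]add1n.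
  rewrite (sum_allwalks_catl e_sym x0) sum_allwalks big_distrr -sum_nat_const.
  apply: leq_sum => x _; rewrite (leq_trans _ (_ : Qd * S x <= _)) //; last first.
    by rewrite leqNgt noS.
  rewrite leq_mul2l leq_sum ?orbT // => q _; rewrite sum_walksS.
  by apply: leq_sum => a _; rewrite sum_walks0.
have D0 : 0 < D.
  rewrite lt0n; apply: contraTneq Sx => D0; rewrite /S big1 ?muln0 // => w _.
  by rewrite big_pred0 // => a; apply: (card0_eq (A := e x)); apply/eqP; rewrite -leqn0 -D0.
pose V := [set b | has (fun p => (last x p == b) && good e x0 r j.-1 x p) (walks e j.-1 x)].
pose X := [set a | e x a].
have Vn : #|V| <= D ^ j.-1.
  rewrite (leq_trans _ (size_walks degD _ x)) // -sum1_card -sum1_size.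
  apply: (@leq_trans (\sum_b \sum_(p <- walks e j.-1 x) (last x p == b))).
    rewrite big_mkcond leq_sum // => b _; rewrite inE; case: hasP => // -[q qw /andP[qb _]].
    by rewrite (bigD1_seq q) ?walks_uniq //= qb.
  rewrite exchange_big leq_sum // => q _ /=.
  by rewrite (bigD1 (last x q)) //= eqxx big1 // => b; rewrite eq_sym => /negbTE ->.
have Sd : S x <= (j.-1 * rho) ^ j.-2 * \sum_(b in V) #|[set a in X | L a b]|.
  apply: (@leq_trans (\sum_(p <- walks e j.-1 x) \sum_b
      ((last x p == b) && good e x0 r j.-1 x p) * #|[set a in X | L a b]|)).
    rewrite /S leq_sum // => q _; rewrite [leqRHS](bigD1 (last x q)) //= eqxx /=.
    rewrite (leq_trans _ (leq_addr _ _)) //.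
    rewrite -sum1_card [X in _ * X]big_mkcond big_distrr big_mkcond leq_sum // => a _.
    rewrite !inE; case: (e x a) => //=; have [|//] := boolP (admissible _ _ _ _ _).
    move=> /and3P[/= /andP[_ qU] nl La]; rewrite /L La.
    by rewrite /good /= qU (nolink_catr (p := [:: a])).
  rewrite exchange_big big_distrr [leqRHS]big_mkcond leq_sum //= => b _.
  rewrite -big_distrl /=; case: ifP => [bV|].
    rewrite leq_mul2r (good_walks degD) ?orbT //; last by lia.
    by move=> i ij; apply: rle; lia.
  rewrite inE => /negbT/hasPn none; rewrite big_seq big1 ?mul0n // => q /none.
  by move=> /negbTE ->.
have dn : D * D ^ j.-1 <= Q * \sum_(b in V) #|[set a in X | L a b]|.
  rewrite -expnS prednK ?(ltnW j2) // (leq_trans (ltnW Sx)) // /Q -mulnA.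
  by rewrite leq_mul2l Sd orbT.
have XD : #|X| <= D by rewrite cardsE.
have Dj0 : 0 < D ^ j.-1 by rewrite expn_gt0 D0.
have [A [AX AM nB]] := kovari_sos_turan XD Vn D0 Dj0 QMD dn.
set B := [set b in V | _] in nB.
have AB a b : a \in A -> b \in B -> L a b.
  by move=> aA; rewrite inE => /andP[_ /forall_inP]; apply.
pose W := 2 * Q * (4 * Q) ^ M.
have KB : C + k + 3 <= #|B|.
  have W0 : 0 < W by move: nB; rewrite -/W; case: (W) => //; rewrite mul0n leqNgt Dj0.
  rewrite -(leq_pmul2l W0) (leq_trans QD) // (leq_trans _ nB) //.
  by rewrite -{1}[D]expn1 leq_pexp2l //; lia.
have [u uA] : exists u, u \in A by apply/card_gt0P; rewrite AM; lia.
pose g x := \sum_(w <- walks e p x) (last x w \in B).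
pose c := k * (C.+2 + k).
(* The threshold of [rich_walk], with [c] large enough for every freshness condition in
   [rich_linked]. *)
pose rich := [set x | c * D ^ p < D * g x].
have total : #|B| * r j <= \sum_(w <- walks e j u) (last u w \in B).
  apply: (@leq_trans (\sum_(b in B) \sum_(w <- walks e j u) (last u w == b))).
    rewrite -sum_nat_const; apply: leq_sum => b bB.
    by apply: first_steps => //; apply: AB.
  rewrite exchange_big leq_sum //= => w _.
  have [wB|wB] := boolP (last u w \in B).
    by rewrite (bigD1 (last u w)) //= eqxx big1 // => b /andP[_]; rewrite eq_sym => /negbTE ->.
  by rewrite big1 // => b bB; apply/eqP; rewrite eqb0; apply: contraNneq wB => ->.
have richt : t <= #|rich|.
  rewrite leqNgt; apply/negP => richt.
  have split_j : j = (j - p) + p by lia.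
  (* A rich vertex is reached in at most [D ^ (j - p).-1] ways and left in at most [D ^ p] ways; any
     other vertex sends at most [c * D ^ p / D] walks into [B]. *)
  have : D * \sum_(w <- walks e j u) (last u w \in B) <= (t + c) * D ^ j.
    rewrite {1}split_j sum_walksD.
    apply: (@leq_trans (\sum_(w <- walks e (j - p) u)
        ((\sum_(b in rich) (last u w == b)) * D ^ p.+1 + c * D ^ p))).
      rewrite big_distrr leq_sum //= => w _.
      under eq_bigr do rewrite last_cat.
      have [wr|wr] := boolP (last u w \in rich).
        rewrite (bigD1 (last u w)) //= eqxx mulnDl mul1n -addnA.
        rewrite (leq_trans _ (leq_addr _ _)) // expnS leq_mul2l -[D ^ p]mul1n.
        by rewrite sum_walks_le ?orbT // => q _; case: (_ \in _).
      rewrite (leq_trans _ (leq_addl _ _)) //.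
      by move: wr; rewrite inE -leqNgt.
    rewrite big_split mulnDl /=; apply: leq_add.
      rewrite -big_distrl exchange_big /=.
      have -> : D ^ j = D ^ (j - p).-1 * D ^ p.+1 by rewrite -expnD; congr expn; lia.
      rewrite mulnA leq_mul2r; apply/orP; right.
      apply: (@leq_trans (#|rich| * D ^ (j - p).-1)).
        rewrite -sum_nat_const leq_sum // => b _.
        have {1}-> : j - p = (j - p).-1.+1 by lia.
        exact: sum_walks_last.
      by rewrite leq_mul2r (ltnW richt) orbT.
    rewrite {2}split_j addnC expnD mulnA; exact: sum_walks_le.
  move=> upper.
  have : W * (t + c) * D ^ j < W * (D * \sum_(w <- walks e j u) (last u w \in B)).
    rewrite (leq_trans (_ : _ < r j * D ^ j)) //.
      by rewrite ltn_pmul2r // expn_gt0 D0.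
    apply: (@leq_trans (W * (D * (#|B| * r j)))); last first.
      by rewrite !leq_mul2l total !orbT.
    have -> : D ^ j = D * D ^ j.-1 by rewrite -expnS prednK ?(ltnW j2).
    rewrite [leqLHS]mulnCA [leqRHS]mulnCA leq_mul2l mulnA [leqRHS]mulnC leq_mul2l.
    by rewrite nB !orbT.
  by apply/negP; rewrite -leqNgt -[W * (t + c) * _]mulnA leq_mul.
exists (take t (enum rich)); split.
- by rewrite size_takel // -cardE.
- by rewrite take_uniq ?enum_uniq.
move=> y z /mem_take + /mem_take; rewrite !mem_enum !inE => yr zr yz.
apply: (rich_linked (A := A) (B := B) (r := r j) (c := c)) => //.
- by lia.
- by rewrite AM.
by rewrite /c /k; apply: leq_mul; lia.
Qed.

End ShortLinks.

(** * Ramsey and Turán *)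

(** Induction on the sum of the sizes [tau]. By the pigeonhole principle the head of the list has,
    in some colour [h], enough related entries for the induction with [tau h] lowered by one; the
    head then extends a list found in colour [h]. *)
Lemma ramsey c (tau : 'I_c -> nat) : 0 < c ->
  exists R, forall (X : eqType) (col : 'I_c -> rel X) (s : seq X), R <= size s ->
    pairwise (fun x y => [exists h, col h x y]) s ->
    exists h s', [/\ subseq s' s, size s' = tau h & pairwise (col h) s'].
Proof.
move=> c0; have [n] := ubnP (\sum_h tau h); elim: n tau => // n IHn tau sumtau.
have [h0 /eqP tau0|tau_gt0] := pickP (fun h => tau h == 0).
  by exists 0 => X col s _ _; exists h0, [::]; rewrite sub0seq tau0.
pose dec h h' := tau h' - (h' == h).
have /fin_all_exists[R hR] (h : 'I_c) : exists R, forall (X : eqType)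
    (col : 'I_c -> rel X) (s : seq X), R <= size s ->
    pairwise (fun x y => [exists h, col h x y]) s ->
    exists h' s', [/\ subseq s' s, size s' = dec h h' & pairwise (col h') s'].
  apply: IHn; rewrite (bigD1 h) //= /dec eqxx.
  rewrite (eq_bigr tau) => [|h' /negbTE ->]; last by rewrite subn0.
  move: sumtau; rewrite (bigD1 h) //=.
  by have := tau_gt0 h; case: (tau h) => //= m _; rewrite subn1.
exists (\sum_h R h).+1 => X col [//|x s] /= sR /andP[/allP xs ss].
have [h Rh] : exists h, R h <= count (col h x) s.
  apply/existsP; apply: contraLR sR => /existsPn lt; rewrite -ltnNge ltnS.
  have le : size s <= \sum_h count (col h x) s.
    under eq_bigr do rewrite -sum1_count big_mkcond.
    rewrite exchange_big -sum1_size big_seq [leqRHS]big_seq; apply: leq_sum => y /xs.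
    by move=> /existsP[h xy] /=; rewrite (bigD1 h) //= xy.
  rewrite (leq_ltn_trans le) // -(ltn_add2r #|'I_c|) -[X in _ + X < _]sum1_card.
  rewrite -big_split /= (@leq_ltn_trans (\sum_h R h)) //; last first.
    by rewrite -{1}[\sum_h R h]addn0 ltn_add2l card_ord.
  by apply: leq_sum => h _; rewrite addn1 ltnNge lt.
have [|| h' [s' [ss' sz pw]]] := hR h X col (filter (col h x) s).
- by rewrite size_filter.
- exact: subseq_pairwise (filter_subseq _ _) ss.
have [E|ne] := eqVneq h' h; last first.
  exists h', s'; split=> //; last by rewrite sz /dec (negbTE ne) subn0.
  by apply: subseq_trans (subseq_trans ss' (filter_subseq _ _)) (subseq_cons _ _).
rewrite E in pw sz; exists h, (x :: s'); split.
- by rewrite /= eqxx (subseq_trans ss') ?filter_subseq.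
- by rewrite /= sz /dec eqxx subn1 prednK // lt0n tau_gt0.
rewrite /= pw andbT; apply/allP => y /(mem_subseq ss').
by rewrite mem_filter => /andP[].
Qed.

Section Turan.

Variables (X : eqType) (E : rel X).
Hypotheses (E_refl : reflexive E) (E_sym : symmetric E).

Lemma maximal_independent (s : seq X) : exists A, [/\ subseq A s,
  pairwise (fun x y => ~~ E x y) A & {in s, forall y, has (E y) A}].
Proof.
elim: s => [|x s [A [As Aind Amax]]]; first by exists [::].
have [xA|xA] := boolP (has (E x) A).
  exists A; split=> //; first by apply: subseq_trans As (subseq_cons _ _).
  by move=> y; rewrite inE => /predU1P[->//|/Amax].
exists (x :: A); split; first by rewrite /= eqxx.
  by rewrite /= Aind andbT all_predC.
move=> y; rewrite inE /= => /predU1P[->|/Amax ->]; rewrite ?E_refl ?orbT //.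
Qed.

(** A maximal independent list of low entries has fewer than [R] members and dominates the low
    entries, which are therefore at most half of [s]. Each other entry has degree at least
    [size s / (2 * R)]. *)
Lemma turan R (s : seq X) :
  (forall A, subseq A s -> pairwise (fun x y => ~~ E x y) A -> size A < R) ->
  size s ^ 2 <= 4 * R * \sum_(x <- s) count (E x) s.
Proof.
move=> small; pose d x := count (E x) s.
pose low x := 2 * R * d x < size s.
have R0 : 0 < R by apply: (small [::]); rewrite // sub0seq.
have halflow : 2 * count low s <= size s.
  have [A [As Aind Amax]] := maximal_independent (filter low s).
  have sA : size A < R by apply: small Aind; apply: subseq_trans As (filter_subseq _ _).
  have : 2 * R * count low s <= size A * size s.
    apply: (@leq_trans (2 * R * \sum_(a <- A) d a)).
      rewrite leq_mul2l -size_filter -sum1_size; apply/orP; right.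
      apply: (@leq_trans (\sum_(y <- filter low s) \sum_(a <- A) E a y)).
        rewrite big_seq [leqRHS]big_seq leq_sum // => y /Amax /hasP[a aA ya].
        by rewrite (big_rem a) //= E_sym ya.
      rewrite exchange_big leq_sum //= => a _.
      rewrite big_filter /d -sum1_count [leqRHS]big_mkcond [leqLHS]big_mkcond leq_sum //.
      by move=> y _; case: (low y); case: (E a y).
    rewrite big_distrr -[size A]sum1_size big_distrl /=.
    rewrite big_seq [leqRHS]big_seq leq_sum // => a /(mem_subseq As).
    by rewrite mem_filter mul1n => /andP[/ltnW].
  move=> le; rewrite -(leq_pmul2l R0) mulnCA mulnA (leq_trans le) //.
  by rewrite leq_mul2r (ltnW sA) orbT.
have : 2 * R * \sum_(x <- s) d x >= (size s - count low s) * size s.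
  rewrite -[in X in X - _](count_predC low s) addKn -sum1_count big_distrl big_distrr /=.
  rewrite [leqLHS]big_mkcond; apply: leq_sum => x _ /=.
  by rewrite /low; case: (ltnP (2 * R * d x) (size s)) => //=; rewrite mul1n.
move: halflow; move: (count low s) (size s) (\sum_(_ <- _) _) => a b S ab le.
have {}le : 2 * ((b - a) * b) <= 2 * (2 * (R * S)) by rewrite leq_mul2l mulnA le.
have : b * b <= 2 * ((b - a) * b) by rewrite mulnA leq_mul2r; apply/orP; right; lia.
rewrite expnS expn1 -(mulnA 4); lia.
Qed.

End Turan.

(** The Cauchy-Schwarz inequality against the constant 1. *)
Lemma sqr_sum (T : finType) (a : T -> nat) :
  (\sum_x a x) ^ 2 <= #|T| * \sum_x a x ^ 2.
Proof.
rewrite -(leq_pmul2l (isT : 0 < 2)) expnS expn1.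
have -> : 2 * (#|T| * \sum_x a x ^ 2) = \sum_x \sum_y (a x ^ 2 + a y ^ 2).
  under [RHS]eq_bigr do rewrite big_split sum_nat_const /=.
  by rewrite [RHS]big_split sum_nat_const -big_distrr /= mul2n addnn.
rewrite big_distrl big_distrr leq_sum //= => x _.
rewrite big_distrr big_distrr leq_sum //= => y _.
exact: nat_Cauchy.
Qed.

(** * Counting candidate walks *)

Section Candidates.

Variables (T : finType) (e : rel T).
Hypotheses (e_sym : symmetric e) (e_irr : irreflexive e).
Variables (x0 : T) (r : nat -> nat) (C l : nat).
Let k := l + l.

Definition linked_clique t :=
  exists s, [/\ size s = t, uniq s & {in s &, forall x y, x != y -> linked e C k x y}].

(** [w] is made of two legs from the centre, at position [l]; the pairs tested are at distance
    [h.+1] from the centre on either side. *)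
Definition candidate (W : {set T}) w :=
  [&& head x0 w \in W, last x0 w \in W
    & [forall h : 'I_l, (nth x0 w (l - h.+1) == nth x0 w (l + h.+1)) ||
         ~~ linked e C k (nth x0 w (l - h.+1)) (nth x0 w (l + h.+1))]].

(** Fix the centre. Among [R] legs no two of which form a candidate, Ramsey's theorem finds [t]
    whose vertices at one common distance are linked, a linked clique. So [turan] gives many
    candidates at this centre, and Cauchy-Schwarz sums over the centres. *)
Lemma many_candidates (W : {set T}) R t :
  (forall (X : eqType) (col : 'I_l -> rel X) (s : seq X), R <= size s ->
     pairwise (fun x y => [exists h, col h x y]) s ->
     exists h s', [/\ subseq s' s, size s' = t & pairwise (col h) s']) ->
  ~ linked_clique t ->
  (\sum_x \sum_(p <- walks e l x) (last x p \in W)) ^ 2 <=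
  #|T| * (4 * R * \sum_(w <- allwalks e k) candidate W w).
Proof.
move=> ramseyR noclique; apply: leq_trans (sqr_sum _) _; rewrite leq_mul2l.
apply/orP; right; rewrite (sum_allwalks_catl e_sym x0) sum_allwalks big_distrr /=.
apply: leq_sum => x _.
pose s := [seq p <- walks e l x | last x p \in W].
(* A leg omits the centre, so its entry [h] is at distance [h.+1]. *)
pose col (h : 'I_l) (q p : seq T) :=
  (nth x0 q h != nth x0 p h) && linked e C k (nth x0 q h) (nth x0 p h).
pose E q p := ~~ [exists h, col h q p].
have -> : \sum_(p <- walks e l x) (last x p \in W) = size s.
  by rewrite size_filter -sum1_count [RHS]big_mkcond.
have colC h : symmetric (col h).
  by move=> q p; rewrite /col eq_sym linked_sym.
have E_refl : reflexive E.
  by move=> q; apply/existsPn => h; rewrite /col eqxx.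
have E_sym : symmetric E.
  by move=> q p; congr (~~ _); apply: eq_existsb => h; rewrite colC.
have small A : subseq A s -> pairwise (fun q p => ~~ E q p) A -> size A < R.
  move=> _ pwA; rewrite ltnNge; apply/negP => RA.
  have [|h [s' [_ sz pw]]] := ramseyR _ col A RA.
    by apply: sub_pairwise pwA => q p; rewrite /E negbK.
  apply: noclique; exists (map (fun q => nth x0 q h) s'); split.
  - by rewrite size_map.
  - by rewrite uniq_pairwise pairwise_map; apply: sub_pairwise pw => q p /andP[].
  have : all2rel (fun u v => (u == v) || linked e C k u v) (map (fun q => nth x0 q h) s').
    rewrite -pairwise_all2rel.
    - by rewrite pairwise_map; apply: sub_pairwise pw => q p /andP[_ /= ->]; rewrite orbT.
    - by move=> u; rewrite eqxx.
    by move=> u v; rewrite eq_sym linked_sym.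
  by move=> /allrelP al u v us vs /negbTE uv; have := al u v us vs; rewrite uv.
apply: leq_trans (turan E_refl E_sym small) _; rewrite leq_mul2l; apply/orP; right.
rewrite big_filter [leqLHS]big_mkcond big_seq [leqRHS]big_seq leq_sum //= => p.
rewrite mem_walks => /andP[/eqP sp xp]; case: ifP => // pW.
rewrite -sum1_count big_filter_cond [leqLHS]big_mkcond big_seq [leqRHS]big_seq.
apply: leq_sum => q; rewrite mem_walks => /andP[/eqP sq xq].
case: ifP => // /andP[qW Epq]; rewrite lt0b; apply/and3P; split.
- by case: (lastP q) qW => // q' y; rewrite last_rcons rev_rcons.
- by rewrite last_cat.
apply/forallP => h; have hl := ltn_ord h.
have -> : nth x0 (rev q ++ x :: p) (l - h.+1) = nth x0 q h.
  rewrite nth_cat size_rev sq ifT; last by lia.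
  by rewrite nth_rev sq; [congr nth; lia | lia].
have -> : nth x0 (rev q ++ x :: p) (l + h.+1) = nth x0 p h.
  by rewrite nth_cat size_rev sq ifF ?addKn //; lia.
move/existsPn: Epq => /(_ h); rewrite /col negb_and negbK eq_sym linked_sym //.
Qed.

Lemma sum_walks_into (W : {set T}) :
  \sum_x \sum_(p <- walks e l x) (last x p \in W) = \sum_(x in W) size (walks e l x).
Proof.
transitivity (\sum_(w <- allwalks e l) (last x0 w \in W)); first by rewrite sum_allwalks.
rewrite sum_allwalks_rev // [RHS]big_mkcond sum_allwalks; apply: eq_bigr => x _.
under eq_bigr => p _ do rewrite rev_cons last_rcons.
by rewrite -sum1_size; case: (x \in W) => //; rewrite big1.
Qed.

Lemma walks_ge d j x : (forall y, d <= #|e y|) -> d ^ j <= size (walks e j x).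
Proof.
move=> ge; elim: j x => // j IHj x; rewrite -sum1_size sum_walksS.
apply: (@leq_trans (\sum_(y | e x y) d ^ j)).
  by rewrite sum_nat_const expnS leq_mul2r ge orbT.
by apply: leq_sum => y _; rewrite sum1_size IHj.
Qed.

Variable D : nat.
Hypothesis degD : forall x, #|e x| <= D.

(** [w] stands for the segment from position [i] of a walk of length [k]. Its entries [g - i] and
    [k - g - i] are the entries [g] and [k - g] of the whole walk, at equal distance from the
    centre, so in a candidate they are equal or unlinked. *)
Definition blocked g i w :=
  [&& linked e (r (k - g)) (k - g) (head x0 w) (last x0 w),
      nth x0 w (g - i) != nth x0 w (k - g - i)
    & ~~ linked e C k (nth x0 w (g - i)) (nth x0 w (k - g - i))].

Definition blocked_const := k * (C.+2 + k) + k * (C.+2 + k).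

(** The inner pair is unlinked at length [k], yet [g - i] and [i] further steps lead from it to ends
    linked at length [k - g]. The three lengths add up to [k], so [unlinked_extensions] applies. *)
Lemma few_blocked g i : g < l -> i <= g -> C + k <= r (k - g) ->
  D * \sum_(w <- allwalks e (k - g)) blocked g i w <= #|T| * D ^ (k - g) * blocked_const.
Proof.
move=> gl ig Cr.
(* The middle part, between the unlinked vertices, has length [k - g - g]. *)
have {1}-> : k - g = g - i + (k - g - g) + i by rewrite /k; lia.
rewrite (sum_allwalks_catr e x0) (sum_allwalks_catl e_sym x0).
pose c := blocked_const * D ^ g.
apply: (@leq_trans (\sum_(w <- allwalks e (k - g - g)) c)); last first.
  rewrite big_const_seq iter_addn_0 count_predT mulnC.
  have -> : D ^ (k - g) = D ^ (k - g - g) * D ^ g by rewrite -expnD; congr expn; rewrite /k; lia.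
  rewrite /c [_ * D ^ g]mulnC !mulnA !leq_mul2r.
  by rewrite size_allwalks // !orbT.
rewrite big_distrr big_seq [leqRHS]big_seq leq_sum // => w.
rewrite mem_allwalks => /andP[/eqP sw _] /=.
set x := head x0 w; set y := last x0 w.
have [xy|xy] := boolP ((x != y) && ~~ linked e C k x y); last first.
  rewrite (_ : \sum_(_ <- _) _ = 0) ?muln0 // big_seq big1 // => q.
  rewrite mem_walks => /andP[/eqP sq _]; rewrite big_seq big1 // => p.
  rewrite mem_walks => /andP[/eqP sp _]; apply/eqP; rewrite eqb0; apply: contra xy.
  have nx : nth x0 ((rev q ++ w) ++ p) (g - i) = x.
    by rewrite -catA nth_cat size_rev sq ltnn subnn nth_cat sw /= nth0.
  have ny : nth x0 ((rev q ++ w) ++ p) (k - g - i) = y.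
    rewrite -catA nth_cat size_rev sq ifF; last by rewrite /k; lia.
    rewrite nth_cat sw ifT; last by rewrite /k; lia.
    by rewrite (_ : k - g - i - (g - i) = (size w).-1) ?nth_last // sw /k; lia.
  by rewrite /blocked nx ny => /and3P[_ -> ->].
case/andP: xy => xy nlk.
have abk : g - i + (k - g) + i = k by rewrite /k; lia.
have Cr' : C + (g - i) + i <= r (k - g) by rewrite (leq_trans _ Cr) // /k; lia.
apply: leq_trans (_ : _ <= D * \sum_(q <- walks e (g - i) x) \sum_(p <- walks e i y)
    linked e (r (k - g)) (k - g) (last x q) (last y p)) _.
  rewrite leq_mul2l; apply/orP; right; rewrite leq_sum // => q _.
  rewrite last_cat -/(last x0 w) (_ : last _ w = y); last first.
    by rewrite /y; case: (w) sw.
  rewrite leq_sum // => p _; rewrite /blocked -catA !last_cat.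
  rewrite (_ : head _ _ = last x q); last first.
    rewrite /x; case: (lastP q) => [|q' z]; last by rewrite last_rcons rev_rcons.
    by case: (w) sw.
  rewrite (_ : last (last _ w) p = last y p); last first.
    by rewrite /y; case: (w) sw.
  set b := linked _ _ _ (last x q) _; clearbody b; case: b => //=; exact: leq_b1.
apply: leq_trans (unlinked_extensions e_sym degD abk Cr' xy nlk) _.
rewrite (_ : g - i + i = g); last by lia.
rewrite leq_mul2r; apply/orP; right; rewrite /blocked_const /k.
by apply: leq_add; apply: leq_mul; lia.
Qed.

Definition good_walk (W : {set T}) w :=
  [&& head x0 w \in W, last x0 w \in W, uniq w & nolink e x0 r k w].

(** A path with a link has an admissible segment by [first_link]. One of length [j] at most [l]
    falls under the third term. A longer one contains the positions [k - j] and [j], symmetric about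
    the centre, and is blocked with [g = k - j]. *)
Lemma candidate_cases W w : w \in allwalks e k ->
  candidate W w <= good_walk W w + ~~ uniq w
    + \sum_(2 <= j < l.+1) \sum_(i < k.+1)
        (i + j <= k) * admissible e x0 r j (take j.+1 (drop i w))
    + \sum_(g < l) \sum_(i < g.+1) blocked g i (take (k - g).+1 (drop i w)).
Proof.
rewrite mem_allwalks => /andP[/eqP sw _].
have [/and3P[hW lW /forallP cand]|//] := boolP (candidate W w).
have [wU|] := boolP (uniq w); last by lia.
have [nl|] := boolP (nolink e x0 r k w); first by rewrite /good_walk hW lW wU nl; lia.
move=> /(first_link sw wU)[j [i [j2 ij adm]]].
have [jl|jl] := leqP j l.
  rewrite (bigD1_seq j) ?iota_uniq ?mem_index_iota ?j2 //=.
  have ik : i < k.+1 by lia.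
  by rewrite (bigD1 (Ordinal ik)) //= ij adm; lia.
have gl : k - j < l by rewrite /k; lia.
have ig : i < (k - j).+1 by lia.
rewrite [X in _ + X](bigD1 (Ordinal gl)) //= [X in _ + (X + _)](bigD1 (Ordinal ig)) //=.
suff -> : blocked (k - j) i (take (k - (k - j)).+1 (drop i w)) by lia.
have -> : k - (k - j) = j by lia.
rewrite /blocked (_ : k - (k - j) = j); last by lia.
have sj : size (take j.+1 (drop i w)) = j.+1.
  by rewrite size_takel // size_drop sw; lia.
case/and3P: adm => _ _ ->.
rewrite !nth_take ?ltnS ?leq_subr //; last by lia.
have i_le : i <= k - j by lia.
have i_lej : i <= j by lia.
rewrite !nth_drop (subnKC i_le) (subnKC i_lej).
have hl : j - l.+1 < l by rewrite /k in ij; lia.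
have := cand (Ordinal hl); rewrite /= (_ : l - (j - l.+1).+1 = k - j); last by rewrite /k; lia.
rewrite (_ : l + (j - l.+1).+1 = j); last by lia.
have ne : nth x0 w (k - j) != nth x0 w j.
  by rewrite nth_uniq ?sw //; rewrite /k; lia.
by rewrite (negbTE ne) /= => ->.
Qed.

(** Compared with [#|T| * D ^ k], repeated vertices and blocked segments are rarer by a factor [D],
    short links by a factor [Qd], up to constants that include the positions of the segments. *)
Lemma candidates_bound W Qd :
  (forall j, 2 <= j <= l ->
     Qd * \sum_(w <- allwalks e j) admissible e x0 r j w <= #|T| * D ^ j) ->
  (forall j, l < j <= k -> C + k <= r j) ->
  D * Qd * \sum_(w <- allwalks e k) candidate W w <=
  D * Qd * \sum_(w <- allwalks e k) good_walk W w +
  #|T| * D ^ k * (Qd * (k * (1 + k)) + D * (k.+1 * k.+1) + Qd * (k.+1 * k.+1 * blocked_const)).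
Proof.
move=> short long.
set N := #|T|.
apply: (@leq_trans (D * Qd * (\sum_(w <- allwalks e k) good_walk W w +
    \sum_(w <- allwalks e k) ~~ uniq w +
    \sum_(2 <= j < l.+1) \sum_(i < k.+1) \sum_(w <- allwalks e k)
        (i + j <= k) * admissible e x0 r j (take j.+1 (drop i w)) +
    \sum_(g < l) \sum_(i < g.+1) \sum_(w <- allwalks e k)
        blocked g i (take (k - g).+1 (drop i w))))).
  rewrite leq_mul2l; apply/orP; right.
  under [X in _ <= _ + X + _]eq_bigr => j _ do rewrite exchange_big.
  under [X in _ <= _ + X]eq_bigr => j _ do rewrite exchange_big.
  rewrite [X in _ <= _ + X + _]exchange_big [X in _ <= _ + X]exchange_big /=.
  rewrite -!big_split big_seq [leqRHS]big_seq leq_sum //= => w.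
  exact: candidate_cases.
have Bnu : D * \sum_(w <- allwalks e k) ~~ uniq w <= N * D ^ k * (k * (1 + k)).
  rewrite sum_allwalks big_distrr -[N * _ * _]mulnA -sum_nat_const leq_sum //= => x _.
  rewrite [leqRHS]mulnC.
  rewrite (leq_trans _ (stale_walks degD [:: x] k x)) // leq_mul2l.
  rewrite leq_sum ?orbT // => p _; rewrite /fresh negb_and negb_and orbC !negbK.
  rewrite (_ : has [in [:: x]] p = (x \in p)) //.
  by apply/hasP/idP => [[y yp /[!inE] /eqP <-]|xp] //; exists x; rewrite ?inE.
have seg a j b (P : pred (seq T)) : a + j + b = k ->
    \sum_(w <- allwalks e k) P (take j.+1 (drop a w)) <=
    (\sum_(w <- allwalks e j) P w) * D ^ (a + b).
  by move=> <-; apply: sum_segment.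
have Bsh : Qd * \sum_(2 <= j < l.+1) \sum_(i < k.+1) \sum_(w <- allwalks e k)
    (i + j <= k) * admissible e x0 r j (take j.+1 (drop i w)) <=
    N * D ^ k * (k.+1 * k.+1).
  rewrite big_distrr.
  apply: (@leq_trans (\sum_(2 <= j < l.+1) k.+1 * (N * D ^ k))); last first.
    rewrite sum_nat_const_nat mulnA [leqRHS]mulnC leq_mul2r leq_mul2r; apply/orP; right.
    by rewrite /k; lia.
  rewrite big_nat [leqRHS]big_nat leq_sum // => j jl.
  rewrite big_distrr -[k.+1 in leqRHS]card_ord -sum_nat_const leq_sum //= => i _.
  have [ijk|_] := leqP (i + j) k; last by rewrite big1 ?muln0.
  under eq_bigr do rewrite mul1n.
  have ab : i + j + (k - j - i) = k by lia.
  rewrite (leq_trans (leq_mul (leqnn Qd) (seg _ _ _ _ ab))) // mulnA.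
  have -> : D ^ k = D ^ j * D ^ (i + (k - j - i)) by rewrite -expnD; congr expn; lia.
  rewrite [leqRHS]mulnA leq_mul2r short ?orbT //; lia.
have Blo : D * \sum_(g < l) \sum_(i < g.+1) \sum_(w <- allwalks e k)
    blocked g i (take (k - g).+1 (drop i w)) <=
    N * D ^ k * (k.+1 * k.+1 * blocked_const).
  pose c := N * D ^ k * blocked_const.
  rewrite big_distrr.
  apply: (@leq_trans (\sum_(g < l) k.+1 * c)); last first.
    rewrite sum_nat_const card_ord mulnA [k.+1 * k.+1 * _]mulnC mulnA [leqRHS]mulnC.
    by rewrite leq_mul2r leq_mul2r; apply/orP; right; apply/orP; right; rewrite /k; lia.
  rewrite leq_sum // => g _; rewrite big_distrr /=.
  apply: (@leq_trans (\sum_(i < g.+1) c)); last first.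
    rewrite sum_nat_const card_ord leq_mul2r; apply/orP; right.
    by have := ltn_ord g; rewrite /k; lia.
  rewrite leq_sum // => i _; have gl := ltn_ord g; have ig := ltn_ord i.
  have ab : i + (k - g) + (g - i) = k by rewrite /k; lia.
  rewrite (leq_trans (leq_mul (leqnn D) (seg _ _ _ _ ab))) // mulnA.
  have Cr : C + k <= r (k - g) by apply: long; rewrite /k; lia.
  rewrite (leq_trans (leq_mul (few_blocked gl ig Cr) (leqnn _))) // /c -!mulnA.
  rewrite leq_mul2l (mulnC blocked_const) mulnA -expnD.
  by rewrite (_ : k - g + (i + (g - i)) = k) ?leqnn ?orbT //; rewrite /k; lia.
move: Bnu Bsh Blo.
set S1 := \sum_(w <- allwalks e k) ~~ uniq w; set S2 := \sum_(2 <= j < l.+1) _.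
set S3 := \sum_(g < l) _; move: S1 S2 S3 (\sum_(w <- _) _) => S1 S2 S3 G.
move: (k * (1 + k)) (k.+1 * k.+1) (k.+1 * k.+1 * _) => c1 c2 c3 B1 B2 B3.
rewrite !mulnDr -!addnA leq_add2l; apply: leq_add; last apply: leq_add.
- by rewrite [D * Qd]mulnC -mulnA [N * _ * (Qd * _)]mulnCA leq_mul2l B1 orbT.
- by rewrite -mulnA [N * _ * (D * _)]mulnCA leq_mul2l B2 orbT.
by rewrite [D * Qd]mulnC -mulnA [N * _ * (Qd * _)]mulnCA leq_mul2l B3 orbT.
Qed.

Definition joined x y :=
  has (fun p => (last x p == y) && uniq (x :: p)) (walks e k x).

(** By [good_walks], one pair of ends accounts for at most [(k * rho) ^ k.-1] good walks. *)
Lemma good_walks_joined (W : {set T}) rho :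
  0 < l -> (forall i, i <= k -> r i <= rho) ->
  \sum_(w <- allwalks e k) good_walk W w <=
  (k * rho) ^ k.-1 * #|[set z : T * T | [&& z.1 \in W, z.2 \in W & joined z.1 z.2]]|.
Proof.
move=> l0 rle; rewrite sum_allwalks.
have -> : #|[set z : T * T | [&& z.1 \in W, z.2 \in W & joined z.1 z.2]]| =
    \sum_x \sum_y [&& x \in W, y \in W & joined x y].
  by rewrite pair_bigA -sum1_card big_mkcond; apply: eq_bigr => -[x y] _; rewrite inE.
rewrite big_distrr leq_sum //= => x _.
apply: (@leq_trans (\sum_(p <- walks e k x) \sum_y
   (((last x p == y) && good e x0 r k x p) && [&& x \in W, y \in W & joined x y]))).
  rewrite big_seq [leqRHS]big_seq leq_sum // => p pw; rewrite (bigD1 (last x p)) //= eqxx.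
  have [/and4P[/= xW lW xpU nl]|//] := boolP (good_walk W (x :: p)).
  rewrite /good /= xpU nl xW lW /= ltn_addr // lt0b.
  by apply/hasP; exists p; rewrite //= eqxx.
rewrite exchange_big big_distrr leq_sum //= => y _.
case: (boolP [&& _, _ & _]) => _; last by rewrite big1 // => p _; rewrite andbF.
under eq_bigr do rewrite andbT.
by rewrite muln1 (good_walks degD) // leqnn andbT /k; lia.
Qed.

End Candidates.

(** The conditions on [B] make [q] large compared with the constants and small compared with the
    degrees. *)
Definition regular_graph (B q d D k : nat) (T : finType) (e : rel T) :=
  [/\ B <= q, q ^ B <= d, forall x, d <= #|e x| <= D, D <= q * d & #|T| <= q * d ^ k].

(** Constants below [q] are absorbed into one more power of [q]. *)
Lemma expn_mul_le q a b c x : x <= q -> b <= q ^ a -> a < c -> b * x <= q ^ c.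
Proof.
move=> xq ba ac; case: q xq ba => [|q] xq ba.
  by move: xq; rewrite leqn0 => /eqP ->; rewrite muln0.
apply: (@leq_trans (q.+1 ^ a.+1)); first by rewrite expnSr leq_mul.
by rewrite leq_pexp2l.
Qed.

(** [S], the number of candidates, is at least [N / A], and the error is at most [N / (2 * A)]; the
    rest are the good walks [G]. *)
Lemma absorb_error N D Qd S G c1 c2 c3 A q :
  0 < D -> 0 < Qd -> N <= A * S ->
  D * Qd * S <= D * Qd * G + N * (Qd * c1 + D * c2 + Qd * c3) ->
  4 * (c1 + c2 + c3) <= q -> A * q <= Qd -> A * q <= D ->
  N <= 2 * A * G.
Proof.
move=> D0 Q0 NS bound cq AQ AD.
have E1 : 4 * (A * (Qd * (c1 + c3))) <= D * Qd.
  have -> : 4 * (A * (Qd * (c1 + c3))) = (A * (4 * (c1 + c3))) * Qd by lia.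
  by rewrite leq_mul2r (leq_trans _ AD) ?orbT // leq_mul2l (leq_trans _ cq) ?orbT //; lia.
have E2 : 4 * (A * (D * c2)) <= D * Qd.
  have -> : 4 * (A * (D * c2)) = D * (A * (4 * c2)) by lia.
  by rewrite leq_mul2l (leq_trans _ AQ) ?orbT // leq_mul2l (leq_trans _ cq) ?orbT //; lia.
have E3 : D * Qd * N <= D * Qd * (A * G) + N * (A * (Qd * (c1 + c3)) + A * (D * c2)).
  apply: (@leq_trans (A * (D * Qd * S))); first by rewrite mulnCA leq_mul2l NS orbT.
  apply: (@leq_trans (A * (D * Qd * G + N * (Qd * c1 + D * c2 + Qd * c3)))).
    by rewrite leq_mul2l bound orbT.
  by apply: eq_leq; lia.
have {}E1 : N * (4 * (A * (Qd * (c1 + c3)))) <= N * (D * Qd) by rewrite leq_mul2l E1 orbT.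
have {}E2 : N * (4 * (A * (D * c2))) <= N * (D * Qd) by rewrite leq_mul2l E2 orbT.
have X0 : 0 < D * Qd by rewrite muln_gt0 D0.
rewrite -(leq_pmul2l X0); move: E3; rewrite mulnDr.
have -> : D * Qd * (2 * A * G) = 2 * (D * Qd * (A * G)) by lia.
move: E1 E2; rewrite !(mulnCA _ 4) [D * Qd * N]mulnC.
move: (N * (A * (Qd * _))) (N * (A * (D * _))) (N * (D * Qd)) (D * Qd * (A * G)).
by move=> y1 y2 y3 y4; clear; lia.
Qed.

(** * Choice of the constants *)

Section Numerics.

Variables (C t l w R : nat).
Let k := l + l.

(** One more than the exponent [w + w + k + 1] of [q] lost when counting candidates: walks rarer by
    [q ^ sparsity] are negligible. *)
Definition sparsity := w + w + k + 2.

(** Links at length [j] get robustness [q ^ robustness j], which has to exceed the bound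
    [2 * Q * (4 * Q) ^ M * q] coming from [dense_short_links]; there [Q] is at most [q ^ (sparsity +
    k.+1 * (robustness j.-1).+1)] and [M.+1] is [C + k + 4]. *)
Fixpoint robustness j :=
  if j is j'.+1 then
    (C + k + 4) * (sparsity + k.+1 * (robustness j').+1).+1 + 2
  else 1.

Lemma robustness_gt0 j : 0 < robustness j.
Proof. by case: j => //= j; rewrite addn2. Qed.

Lemma robustness_mono : {homo robustness : i j / i <= j}.
Proof.
apply: homo_leq => // [j i n|j]; first exact: leq_trans.
rewrite /=; move: (robustness j) => u.
apply: (@leq_trans (sparsity + k.+1 * u.+1).+1).
  by rewrite mulSn; lia.
by rewrite (leq_trans _ (leq_addr _ _)) // leq_pmull //; lia.
Qed.

(** There are many candidates, at least half of them are good, and a joined pair carries few good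
    walks. *)
Lemma many_joined : 0 < l ->
  (forall (X : eqType) (col : 'I_l -> rel X) (s : seq X), R <= size s ->
     pairwise (fun x y => [exists h, col h x y]) s ->
     exists h s', [/\ subseq s' s, size s' = t & pairwise (col h) s']) ->
  exists w' B, forall (T : finType) (e : rel T) (x0 : T) q d D,
  symmetric e -> irreflexive e -> regular_graph B q d D k e ->
  ~ linked_clique e C l t -> forall W : {set T}, #|T| <= q ^ w * #|W| ->
  #|T| * D ^ k <=
  q ^ w' * #|[set z : T * T | [&& z.1 \in W, z.2 \in W & joined e l z.1 z.2]]|.
Proof.
move=> l0 ramseyR.
pose M := C + k + 3.
pose c2 := k.+1 * k.+1.
pose c1 := k * (1 + k).
pose c3 := c2 * blocked_const C l.
pose a := sparsity.-1.
exists (a.+1 + (robustness k).+1 * k).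
exists (4 * R + 4 * M + 4 * (c1 + c2 + c3) + (t + k * (C.+2 + k)).+1 + k +
  robustness k + sparsity).
move=> T e x0 q d D e_sym e_irr [Bq qd degs Dqd Nd] noclique W WN.
pose r i := q ^ robustness i.
have degD x : #|e x| <= D by have /andP[] := degs x.
have degd x : d <= #|e x| by have /andP[] := degs x.
have dD : d <= D by apply: leq_trans (degd x0) (degD x0).
have [M4q R4q cq tq [kq Bpq]] : [/\ 4 * M <= q, 4 * R <= q, 4 * (c1 + c2 + c3) <= q,
    t + k * (C.+2 + k) < q & k <= q /\ robustness k + sparsity <= q].
  move: Bq; move: (robustness k) (C.+2 + k) (c1 + c2 + c3) (sparsity) (M) => b c c' z M'.
  by move: (k * c) => kc; clear; move=> ?; do !split; lia.
have Mq : C + k + 3 <= q by apply: leq_trans M4q; rewrite leq_pmull.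
have q1 : 1 < q by apply: leq_trans M4q; rewrite /M; clear; lia.
have q0 : 0 < q by apply: ltnW.
have qD c : c <= robustness k + sparsity -> q ^ c <= D.
  move=> cB; apply: leq_trans dD; apply: leq_trans qd; rewrite leq_pexp2l //.
  by apply: leq_trans cB _; rewrite -[X in _ <= X]addnA leq_addl.
have D0 : 0 < D by apply: leq_trans (qD 0 _).
have short j : 2 <= j <= l ->
    q ^ sparsity * \sum_(s <- allwalks e j) admissible e x0 r j s <= #|T| * D ^ j.
  move=> /andP[j2 jl]; rewrite leqNgt; apply/negP => dense; apply: noclique.
  have j0 : 0 < j by apply: ltnW.
  (* Euclidean division makes the length produced by [dense_short_links] equal to [k] for every
     [j]. *)
  have kE : l %% j + l %/ j * (2 * j) + l %% j = k.
    rewrite /k {4 5}(divn_eq l j) mulnCA; move: (l %/ j * j) (l %% j) => y z.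
    by clear; lia.
  have jk : j <= k by rewrite /k (leq_trans jl) ?leq_addr.
  pose rho := robustness j.-1.
  pose phi := sparsity + k.+1 * rho.+1.
  have rj : robustness j = (C + k + 4) * phi.+1 + 2 by rewrite -{1}[j]prednK.
  have rjD : robustness j <= robustness k + sparsity.
    by rewrite (leq_trans (robustness_mono jk)) ?leq_addr.
  pose Q := q ^ sparsity * (j.-1 * q ^ rho) ^ j.-2.
  have jq : j.-1 <= q by apply: leq_trans kq; apply: leq_trans jk; apply: leq_pred.
  have j2k : j.-2 <= k.+1.
    by rewrite (leq_trans (leq_pred _)) // (leq_trans (leq_pred _)) // ltnW.
  have Qle : Q <= q ^ phi.
    rewrite expnD leq_mul2l expn_eq0 -leqn0 leqNgt q0 /=.
    rewrite mulnC expnM; apply: (@leq_trans ((q ^ rho.+1) ^ j.-2)).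
      case: (j.-2) => // n; rewrite leq_exp2r // expnSr leq_mul2l.
      by rewrite jq orbT.
    by rewrite -!expnM leq_pexp2l // mulnC leq_mul2r j2k orbT.
  have Q4 : 4 * Q <= q ^ phi.+1.
    rewrite mulnC; apply: (expn_mul_le _ Qle) => //; apply: leq_trans M4q.
    by rewrite leq_pmulr // /M; clear; lia.
  have Wle : 2 * Q * (4 * Q) ^ M <= q ^ (phi.+1 * M.+1).
    rewrite expnM; apply: (@leq_trans ((4 * Q) ^ M.+1)); last by rewrite leq_exp2r.
    by rewrite expnS leq_mul2r leq_mul2r orbT orbT.
  have M1 : M.+1 = C + k + 4 by rewrite /M; clear; lia.
  have phir : phi.+1 < robustness j.
    rewrite rj; apply: (@leq_ltn_trans ((C + k + 4) * phi.+1)); last by clear; lia.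
    by rewrite leq_pmull //; clear; lia.
  have phiMr : phi.+1 * M.+1 + 1 < robustness j by rewrite rj M1 mulnC; clear; lia.
  have := @dense_short_links T e e_sym e_irr D degD x0 r C t (q ^ sparsity)
    (q ^ rho) j (l %/ j) (l %% j) M.
  cbv zeta; rewrite kE -/Q; apply => //.
  - by rewrite ltn_pmod.
  - by rewrite divn_gt0.
  - move=> i ij; rewrite leq_pexp2l // robustness_mono //.
    by rewrite -ltnS prednK.
  - rewrite mulnAC mulnC; apply: leq_trans (qD _ rjD).
    by apply: (expn_mul_le _ Qle); rewrite // ltnW.
  - apply: leq_trans (qD _ rjD).
    by apply: (expn_mul_le _ Wle); rewrite // ltnW // -addn1.
  - rewrite /r; apply: (@leq_ltn_trans (q ^ (phi.+1 * M.+1 + 1))); last by rewrite ltn_exp2l.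
    by apply: (expn_mul_le _ Wle); rewrite ?addn1 // ltnW.
  - rewrite /r (leq_trans Mq) // -{1}[q]expn1 leq_pexp2l ?robustness_gt0 //.
have N0 : 0 < #|T| by apply/card_gt0P; exists x0.
have step1 : #|T| * D ^ k <= q ^ a * \sum_(s <- allwalks e k) candidate e x0 C l W s.
  have := many_candidates e_sym x0 W ramseyR noclique; rewrite sum_walks_into // => many.
  set S := \sum_(_ <- _) _ in many *.
  have {many} : (#|W| * d ^ l) ^ 2 <= #|T| * (4 * R * S).
    apply: leq_trans many; rewrite leq_exp2r // -sum_nat_const leq_sum // => x _.
    exact: walks_ge.
  move=> many; rewrite -(leq_pmul2l N0).
  (* Replacing [#|T|] by [#|W|] twice costs [q ^ (w + w)], and replacing [D] by [d] costs
     [q ^ k]. *)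
  apply: (@leq_trans (q ^ (w + w + k) * (#|W| * d ^ l) ^ 2)).
    have -> : q ^ (w + w + k) * (#|W| * d ^ l) ^ 2 =
        (q ^ w * #|W|) * ((q ^ w * #|W|) * (q * d) ^ k).
      rewrite expnMn -expnM muln2 -addnn -/k !expnD !expnMn expnS expn1.
      by move: (q ^ w) (q ^ k) (d ^ k) #|W| => b1 b2 b3 b4; clear; lia.
    by rewrite !leq_mul // leq_exp2r ?addn_gt0 ?l0.
  apply: (@leq_trans (q ^ (w + w + k) * (#|T| * (4 * R * S)))).
    by rewrite leq_mul2l many orbT.
  have -> : a = (w + w + k).+1 by rewrite /a /sparsity; clear; lia.
  rewrite mulnCA leq_mul2l expnSr -[X in _ || (_ <= X)]mulnA leq_mul2l leq_mul2r.
  by rewrite R4q !orbT.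
have long j : l < j <= k -> C + k <= r j.
  move=> _; apply: leq_trans (_ : C + k + 3 <= _); first exact: leq_addr.
  by rewrite /r (leq_trans Mq) // -{1}[q]expn1 leq_pexp2l ?robustness_gt0.
have step2 := @candidates_bound T e e_sym x0 r C l D degD W _ short long.
have aS : a.+1 = sparsity by rewrite /a prednK // /sparsity addn2.
have {}step2 : #|T| * D ^ k <= 2 * q ^ a * \sum_(s <- allwalks e k) good_walk e x0 r l W s.
  apply: (absorb_error (N := #|T| * D ^ k) (Qd := q ^ sparsity) (q := q) D0 _ step1 step2) => //.
  - by rewrite expn_gt0 q0.
  - by rewrite -expnSr aS.
  - by rewrite -expnSr qD // aS leq_addl.
have rle i : i <= k -> r i <= q ^ robustness k.
  by move=> ik; rewrite leq_pexp2l // robustness_mono.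
have step3 := @good_walks_joined T e x0 r l D degD W _ l0 rle.
apply: leq_trans step2 _; apply: leq_trans (leq_mul (leqnn _) step3) _.
rewrite mulnA leq_mul2r; apply/orP; right; rewrite expnD; apply: leq_mul.
  by rewrite expnS leq_mul2r q1 orbT.
rewrite expnM; apply: (@leq_trans ((q ^ (robustness k).+1) ^ k.-1)); last first.
  by rewrite leq_pexp2l ?expn_gt0 ?q0 ?leq_pred.
by case: (k.-1) => // n; rewrite leq_exp2r // expnS leq_mul2r kq orbT.
Qed.

End Numerics.

(** * Building the subdivided clique *)

Definition pairs_below m : seq (nat * nat) :=
  [seq z <- [seq (i, j) | i <- iota 0 m, j <- iota 0 m] | z.1 < z.2].

Lemma mem_pairs_below m z : (z \in pairs_below m) = (z.1 < z.2 < m).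
Proof.
case: z => i j; rewrite mem_filter /=.
have [ij|//] := ltnP i j; rewrite /=.
apply/allpairsP/idP => [[[i' j'] /= [_ + [_ ->]]]|jm]; first by rewrite mem_iota.
by exists (i, j); rewrite /= !mem_iota (ltn_trans ij jm) jm.
Qed.

Lemma size_pairs_below m : size (pairs_below m) <= m * m.
Proof. by rewrite size_filter (leq_trans (count_size _ _)) // size_allpairs size_iota. Qed.

Lemma pairs_below_uniq m : uniq (pairs_below m).
Proof.
rewrite filter_uniq // allpairs_uniq ?iota_uniq //.
by move=> [i j] [i' j'] _ _ [-> ->].
Qed.

Section Cliques.

Variables (T : finType) (e : rel T) (x0 : T).
Hypotheses (e_sym : symmetric e) (e_irr : irreflexive e).
Variables (C l : nat).
Hypothesis l_gt0 : 0 < l.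
Let k := l + l.

(** [P z] lists the inner vertices only. Pairs are increasing, like the ranks along an
    [oriented_edge]. *)
Definition subdivided_clique m (b : nat -> T) (P : nat * nat -> seq T) :=
  [/\ forall i j, i < m -> j < m -> b i = b j -> i = j,
      forall z, z.1 < z.2 < m ->
        [/\ size (P z) = k.-1, path e (b z.1) (rcons (P z) (b z.2)), uniq (P z)
          & forall i, i < m -> b i \notin P z]
    & forall z z' x, z.1 < z.2 < m -> z'.1 < z'.2 < m -> x \in P z -> x \in P z' -> z = z'].

Definition used m (b : nat -> T) (P : nat * nat -> seq T) (L : seq (nat * nat)) :=
  [seq b i | i <- iota 0 m] ++ flatten [seq P z | z <- L].

Lemma size_used m b P L : (forall z, z \in L -> size (P z) = k.-1) ->
  size (used m b P L) = m + size L * k.-1.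
Proof.
move=> sP; rewrite size_cat size_map size_iota size_flatten /shape -map_comp; congr (_ + _).
elim: L sP => //= z L IHL sP; rewrite mulSn sP ?mem_head // IHL // => z' z'L.
by apply: sP; rewrite inE z'L orbT.
Qed.

Lemma inner_path (w : seq T) x y : 0 < size w -> last x w = y -> w = rcons (take (size w).-1 w) y.
Proof.
case: (lastP w) => // p z _; rewrite last_rcons size_rcons => ->.
by rewrite -[in take _ _]cats1 take_size_cat.
Qed.

(** Paths are added pair by pair. At most [t + t * t * k] vertices are ever in use, and links of
    robustness [C] can avoid these. *)
Lemma linked_clique_subdivided t : t + t * t * k <= C ->
  linked_clique e C l t -> exists b P, subdivided_clique t b P.
Proof.
move=> tC [s [st sU lk]].
pose b i := nth x0 s i.
have bI i j : i < t -> j < t -> b i = b j -> i = j.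
  by move=> it jt /eqP; rewrite nth_uniq ?st // => /eqP.
suff gen L : {subset L <= pairs_below t} -> uniq L -> size L <= t * t ->
    exists P : nat * nat -> seq T,
    (forall z, z \in L ->
        [/\ size (P z) = k.-1, path e (b z.1) (rcons (P z) (b z.2)), uniq (P z)
          & forall i, i < t -> b i \notin P z])
    /\ (forall z z' x, z \in L -> z' \in L -> x \in P z -> x \in P z' -> z = z').
  have [//||| P [P1 P2]] := gen (pairs_below t).
  - exact: pairs_below_uniq.
  - exact: size_pairs_below.
  exists b, P; split=> //.
    by move=> z zt; apply: P1; rewrite mem_pairs_below.
  by move=> z z' x zt zt'; apply: P2; rewrite mem_pairs_below.
elim: L => [|z L IHL] sub LU sL; first by exists (fun _ => [::]).
have /andP[zL {}LU] : (z \notin L) && uniq L by [].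
have [||P [P1 P2]] := IHL _ LU.
- by move=> z' z'L; apply: sub; rewrite inE z'L orbT.
- exact: ltnW.
have /andP[z12 z2t] : z.1 < z.2 < t by rewrite -mem_pairs_below sub ?mem_head.
have z1t := ltn_trans z12 z2t.
pose U := used t b P L.
have sU' : size U <= C.
  rewrite size_used => [|z' /P1[]//]; apply: leq_trans tC; rewrite leq_add2l.
  by apply: leq_mul; [apply: ltnW|apply: leq_pred].
have bb : b z.1 != b z.2 by apply/eqP => /(bI _ _ z1t z2t) E; rewrite E ltnn in z12.
(* A cut must not contain the two ends, which belong to [U]. *)
have /linkedP/(_ [seq y <- U | (y != b z.1) && (y != b z.2)])[] :
    linked e C k (b z.1) (b z.2).
  by apply: lk => //; rewrite mem_nth // st.
- by rewrite size_filter (leq_trans (count_size _ _)).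
- by rewrite mem_filter eqxx.
- by rewrite mem_filter eqxx andbF.
move=> w [sw bw lw wU /hasPn nw].
have k0 : 0 < k by rewrite addn_gt0 l_gt0.
have wE : w = rcons (take k.-1 w) (b z.2) by have := @inner_path w (b z.1) (b z.2); rewrite sw; apply.
pose p := take k.-1 w; rewrite -/p in wE.
have pU : uniq p by rewrite take_uniq //; case/andP: wU.
have pF y : y \in p -> y \notin U.
  move=> yp; have yw : y \in w by apply: mem_take yp.
  apply: contra (nw y yw) => yU; rewrite mem_filter yU andbT.
  apply/andP; split; first by apply: contraNneq (proj1 (andP wU)) => <-.
  by move: wU; rewrite wE /= rcons_uniq => /and3P[_ + _]; apply: contraNneq => <-.
exists (fun z' => if z' == z then p else P z'); split.
  move=> z'; rewrite inE; case: eqP => [-> _|_ /P1//]; split=> //.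
  - by rewrite size_takel // sw leq_pred.
  - by rewrite -wE.
  move=> i it; apply/negP => /pF; rewrite mem_cat negb_or => /andP[/negP nb _].
  by apply: nb; apply/mapP; exists i; rewrite ?mem_iota.
move=> z1 z2 x; rewrite !inE; case: eqP => [->|_] /=; case: eqP => [->|_] //= z1L z2L.
- move=> /pF + xP; rewrite mem_cat negb_or => /andP[_ /negP[]].
  by apply/flattenP; exists (P z2) => //; apply/mapP; exists z2.
- move=> xP /pF; rewrite mem_cat negb_or => /andP[_ /negP[]].
  by apply/flattenP; exists (P z1) => //; apply/mapP; exists z1.
exact: P2.
Qed.

(** * Conflicts between paths with a common end *)

Definition reach n x y := has (fun p => last x p == y) (walks e n x).

Lemma reach_sym n : symmetric (reach n).
Proof.
suff rC x y : reach n x y -> reach n y x by move=> x y; apply/idP/idP; apply: rC.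
move=> /hasP[p]; rewrite mem_walks => /andP[/eqP sp xp] /eqP lp.
apply/hasP; exists (rev (belast x p)).
  rewrite mem_walks size_rev size_belast sp eqxx -lp rev_path.
  by apply: sub_path xp => u v; rewrite e_sym.
by rewrite -lp; case: (p) => //= z p'; rewrite rev_cons last_rcons.
Qed.

Lemma reach_split n a w x : path e a w -> size w = k -> last a w = x -> n < k ->
  reach n.+1 a (nth x0 w n) /\ reach (k - n.+1) (nth x0 w n) x.
Proof.
move=> aw sw lw nk.
have lt : last a (take n.+1 w) = nth x0 w n.
  by rewrite (take_nth x0) ?sw // last_rcons.
move: aw lw; rewrite -{1 2}(cat_take_drop n.+1 w) cat_path last_cat lt => /andP[p1 p2] lw.
split; apply/hasP.
  by exists (take n.+1 w); rewrite ?lt // mem_walks size_takel ?sw // eqxx.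
by exists (drop n.+1 w); rewrite ?lw // mem_walks size_drop sw eqxx.
Qed.

(** This holds when paths of length [k] from [a] and from [b] to [y] share an inner vertex [v]: let
    [g] be the smaller of the lengths left from [v] to [y]. The larger one is positive, so the sum
    is at most [(k + k).-1]. *)
Definition conflict a b y := [exists v, exists i1 : 'I_k, exists i2 : 'I_k,
  exists g : 'I_k, [&& i1 + i2 + g <= (k + k).-1, reach i1 a v, reach i2 b v & reach g v y]].

(** Two such branch vertices would exclude too many later candidates. *)
Definition dangerous X a b := #|T| < X * #|[set y | conflict a b y]|.

Variable D : nat.
Hypotheses (degD : forall x, #|e x| <= D) (D_gt0 : 0 < D).

Lemma card_reach n x : #|[set y | reach n x y]| <= D ^ n.
Proof.
rewrite (leq_trans _ (size_walks degD n x)) // -sum1_card -sum1_size.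
apply: (@leq_trans (\sum_y \sum_(p <- walks e n x) (last x p == y))).
  rewrite big_mkcond leq_sum // => y _; rewrite inE /reach; case: hasP => // -[q qw qy].
  by rewrite (bigD1_seq q) ?walks_uniq //= qy.
rewrite exchange_big leq_sum // => q _ /=.
by rewrite (bigD1 (last x q)) //= eqxx big1 // => y; rewrite eq_sym => /negbTE ->.
Qed.

(** Given [v] and the three lengths, walking from [v] leaves at most [D ^ (i1 + i2 + g)] triples
    [a], [b], [y]. *)
Lemma sum_conflict : \sum_a \sum_b #|[set y | conflict a b y]| <=
  #|T| * k * k * k * D ^ (k + k).-1.
Proof.
pose Q : finType := (T * 'I_k * 'I_k * 'I_k)%type.
pose A (q : Q) : {set T * T * T} := [set z | [&& q.1.1.2 + q.1.2 + q.2 <= (k + k).-1,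
  reach q.1.1.2 q.1.1.1 z.1.1, reach q.1.2 q.1.1.1 z.1.2 & reach q.2 q.1.1.1 z.2]].
have -> : \sum_a \sum_b #|[set y | conflict a b y]| =
    \sum_(z : T * T * T) conflict z.1.1 z.1.2 z.2.
  rewrite pair_bigA -[RHS](pair_bigA _ (fun ab y => conflict ab.1 ab.2 y : nat)) /=.
  apply: eq_bigr => -[a b] _ /=; rewrite -sum1_card big_mkcond.
  by apply: eq_bigr => y _; rewrite inE.
apply: (@leq_trans (\sum_(z : T * T * T) \sum_(q : Q) (z \in A q))).
  apply: leq_sum => -[[a b] y] _ /=.
  have [/existsP[v /existsP[i1 /existsP[i2 /existsP[g le]]]]|//] := boolP (conflict a b y).
  case/and4P: le => le r1 r2 r3.
  rewrite (bigD1 (v, i1, i2, g)) //= inE /= le reach_sym r1 reach_sym r2 r3.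
  exact: leq_addr.
rewrite exchange_big /=.
apply: (@leq_trans (\sum_(q : Q) D ^ (k + k).-1)); last first.
  by rewrite sum_nat_const !card_prod !card_ord.
apply: leq_sum => -[[[v i1] i2] g] _.
have -> : \sum_z (z \in A (v, i1, i2, g)) = #|A (v, i1, i2, g)|.
  by rewrite -sum1_card [RHS]big_mkcond.
have [le|gt] := boolP (i1 + i2 + g <= (k + k).-1); last first.
  rewrite (_ : A _ = set0) ?cards0 //; apply/setP => z; rewrite !inE /=.
  by rewrite (negbTE gt).
apply: (@leq_trans #|setX (setX [set y | reach i1 v y] [set y | reach i2 v y])
                        [set y | reach g v y]|).
  by apply: subset_leq_card; apply/subsetP => z; rewrite !inE /= => /and4P[_ -> -> ->].
rewrite !cardsX (leq_trans (leq_mul (leq_mul (card_reach _ _) (card_reach _ _)) (card_reach _ _))) //.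
by rewrite -!expnD leq_pexp2l.
Qed.

(** Markov's inequality applied to [sum_conflict]. *)
Lemma few_dangerous X :
  #|[set z : T * T | dangerous X z.1 z.2]| <= X * (k * k * k * D ^ (k + k).-1).
Proof.
have [T0|T0] := posnP #|T|.
  rewrite (leq_trans (subset_leq_card (subsetT _))) // cardsT card_prod T0 //.
rewrite -(leq_pmul2l T0).
apply: (@leq_trans (X * \sum_a \sum_b #|[set y | conflict a b y]|)); last first.
  rewrite mulnCA leq_mul2l (leq_trans sum_conflict) ?orbT // -!mulnA //.
rewrite pair_bigA big_distrr -sum1_card big_distrr /= big_mkcond.
apply: leq_sum => -[a b] _; rewrite inE /=; case: ifP => // /ltnW.
by rewrite muln1.
Qed.

End Cliques.

Lemma card_has_le (T : finType) (I : eqType) (s : seq I) (F : I -> pred T) c :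
  (forall i, i \in s -> #|[set y | F i y]| <= c) ->
  #|[set y | has (fun i => F i y) s]| <= size s * c.
Proof.
elim: s => [|i s IHs] le.
  by rewrite (_ : [set y | _] = set0) ?cards0 //; apply/setP => y; rewrite !inE.
have -> : [set y | has (fun i => F i y) (i :: s)] =
    [set y | F i y] :|: [set y | has (fun i => F i y) s] by apply/setP => y; rewrite !inE.
rewrite (leq_trans (leq_card_setU _ _)) //= mulSn leq_add ?le ?mem_head // IHs //.
by move=> j js; apply: le; rewrite inE js orbT.
Qed.

(** * Picking the branch vertices one by one *)

Section Picking.

Variables (T : finType) (e : rel T) (x0 : T).
Hypotheses (e_sym : symmetric e) (e_irr : irreflexive e).
Variables (l : nat).
Hypothesis l_gt0 : 0 < l.
Let k := l + l.
Let k_gt0 : 0 < k. Proof. by rewrite addn_gt0 l_gt0. Qed.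

Let usedb m b P := @used T m b P (pairs_below m).

Lemma used_branch m b P i : i < m -> b i \in usedb m b P.
Proof. by move=> im; rewrite mem_cat; apply/orP; left; apply/mapP; exists i; rewrite ?mem_iota. Qed.

Lemma used_inner m b P z u : z.1 < z.2 < m -> u \in P z -> u \in usedb m b P.
Proof.
move=> zm uz; rewrite mem_cat; apply/orP; right; apply/flattenP; exists (P z) => //.
by apply/mapP; exists z; rewrite ?mem_pairs_below.
Qed.

(** Inner vertices of the new paths reach [x] in fewer than [k] steps, so the last hypothesis keeps
    them away from all used vertices; two new paths that met would give a conflict. *)
Lemma extend_clique m b P x :
  subdivided_clique e l m b P ->
  (forall i, i < m -> joined e l (b i) x) ->
  (forall i j, i < j < m -> ~~ conflict e l (b i) (b j) x) ->
  (forall u, u \in usedb m b P -> forall n, n < k -> ~~ reach e n u x) ->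
  exists P', subdivided_clique e l m.+1 (fun i => if i == m then x else b i) P'.
Proof.
move=> [bI P1 P2] jo conf far.
have /fin_all_exists[w hw] (i : 'I_m) : exists w, [/\ size w = k, path e (b i) w,
    last (b i) w = x & uniq (b i :: w)].
  have /hasP[p] := jo i (ltn_ord i); rewrite mem_walks => /andP[/eqP sp bp] /andP[/eqP lp pU].
  by exists p.
pose p (i : nat) := if insub i is Some j then take k.-1 (w j) else [::].
have pE i (im : i < m) : p i = take k.-1 (w (Ordinal im)) by rewrite /p insubT.
have pw i (im : i < m) : w (Ordinal im) = rcons (p i) x.
  have [sw _ lw _] := hw (Ordinal im).
  by have := @inner_path _ (w (Ordinal im)) (b i) x; rewrite sw pE; apply.
have sizep i : i < m -> size (p i) = k.-1.
  by move=> im; have [sw _ _ _] := hw (Ordinal im); rewrite pE size_takel // sw leq_pred.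
have p_in : forall i u, i < m -> u \in p i -> exists n, [/\ n < k.-1,
    reach e n.+1 (b i) u & reach e (k - n.+1) u x].
  move=> i u im ui; have [sw bw lw _] := hw (Ordinal im).
  have un : index u (p i) < k.-1 by rewrite -(sizep i im) index_mem.
  exists (index u (p i)).
  have uk : index u (p i) < k by apply: leq_trans un _; apply: leq_pred.
  have [] := reach_split x0 bw sw lw uk.
  by rewrite pw nth_rcons sizep // un nth_index.
have p_new i u : i < m -> u \in p i -> u \notin usedb m b P.
  move=> im /(p_in _ _ im)[n [nk _ r2]]; apply/negP => uU.
  by have := far u uU (k - n.+1); rewrite r2 ltn_subrL k_gt0 => /(_ isT).
have x_new : x \notin usedb m b P.
  by apply/negP => xU; have := far x xU 0 k_gt0; rewrite /reach /= eqxx.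
have xp i : i < m -> x \notin p i.
  move=> im; have [_ _ _] := hw (Ordinal im).
  by rewrite (pw i im) /= rcons_uniq => /and3P[].
have pU i : i < m -> uniq (p i).
  move=> im; have [_ _ _] := hw (Ordinal im).
  by rewrite (pw i im) /= rcons_uniq => /and3P[].
have p_disj i j u : i < j < m -> u \in p i -> u \in p j -> False.
  move=> /andP[ij jm] /(p_in i u (ltn_trans ij jm))[n1 [n1k r1 r1']].
  move=> /(p_in j u jm)[n2 [n2k r2 r2']].
  have := conf i j; rewrite ij jm => /(_ isT)/existsP[]; exists u.
  have h1 : n1.+1 < k by lia.
  have h2 : n2.+1 < k by lia.
  apply/existsP; exists (Ordinal h1); apply/existsP; exists (Ordinal h2).
  have [le|/ltnW le] := leqP n1 n2.
    have h3 : k - n2.+1 < k by rewrite ltn_subrL.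
    by apply/existsP; exists (Ordinal h3) => /=; rewrite r1 r2 r2' !andbT; lia.
  have h3 : k - n1.+1 < k by rewrite ltn_subrL.
  by apply/existsP; exists (Ordinal h3) => /=; rewrite r1 r2 r1' !andbT; lia.
have x_b i : i < m -> b i != x.
  by move=> im; apply: contraNneq x_new => <-; apply: used_branch.
exists (fun z => if z.2 == m then p z.1 else P z); split.
- move=> i j; rewrite !ltnS [i <= m]leq_eqVlt [j <= m]leq_eqVlt.
  case: eqP => [->|_] /=; case: eqP => [->|_] //= im jm.
  + by move=> /eqP; rewrite eq_sym (negbTE (x_b j jm)).
  + by move=> /eqP; rewrite (negbTE (x_b i im)).
  exact: bI.
- move=> z /andP[z12]; rewrite ltnS leq_eqVlt; case: eqP => [z2m _|_ /= z2m].
    have z1m : z.1 < m by rewrite -z2m.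
    rewrite (ltn_eqF z1m) sizep // pU // -(pw _ z1m).
    have [_ bw _ _] := hw (Ordinal z1m); split=> // i; rewrite ltnS leq_eqVlt.
    case: eqP => [_ _|_ /= im]; first exact: xp.
    by apply/negP => /(p_new _ _ z1m); rewrite used_branch.
  have zm : z.1 < z.2 < m by rewrite z12.
  have [s1 s2 s3 s4] := P1 z zm; rewrite (ltn_eqF (ltn_trans z12 z2m)); split=> // i.
  rewrite ltnS leq_eqVlt; case: eqP => [_ _|_ /= im]; last exact: s4.
  by apply: contra x_new => xP; apply: used_inner xP.
move=> z z' u /andP[z12 +] /andP[z12' +].
rewrite !ltnS [z.2 <= m]leq_eqVlt [z'.2 <= m]leq_eqVlt.
case: eqP => [zm _|_ /= zm]; case: eqP => [zm' _|_ /= zm'].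
- rewrite zm in z12; rewrite zm' in z12' => uz uz'.
  rewrite [z]surjective_pairing [z']surjective_pairing zm zm'; congr (_, _).
  have [lt|lt|//] := ltngtP z.1 z'.1.
    by case: (@p_disj z.1 z'.1 u); rewrite ?lt.
  by case: (@p_disj z'.1 z.1 u); rewrite ?lt.
- rewrite zm in z12 => /(p_new _ _ z12) /negP uU uz; case: uU.
  by apply: used_inner uz; rewrite z12'.
- rewrite zm' in z12' => uz /(p_new _ _ z12') /negP; case.
  by apply: used_inner uz; rewrite z12.
by apply: P2; rewrite ?z12 ?z12'.
Qed.

(** [W] holds the possible next branch vertices. They satisfy the hypotheses of [extend_clique], and
    absence of danger keeps later conflicts rare. *)
Definition partial_clique w X m :=
  exists b P (W : {set T}), [/\ subdivided_clique e l m b P, #|T| <= w * #|W|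
    & forall y, y \in W -> [/\ forall i, i < m -> joined e l (b i) y,
        forall i, i < m -> ~~ dangerous e l X (b i) y,
        forall i j, i < j < m -> ~~ conflict e l (b i) (b j) y
      & forall u, u \in usedb m b P -> forall n, n < k -> ~~ reach e n u y]].

Lemma partial_clique0 X : partial_clique 1 X 0.
Proof.
exists (fun _ => x0), (fun _ => [::]), [set: T]; rewrite mul1n cardsT; split=> //.
  by split=> [i j|z|z z' x]; rewrite ?ltn0 ?andbF.
by move=> y _; split=> [i|i|i j|u]; rewrite ?ltn0 ?andbF.
Qed.

Lemma partial_clique_weaken w w' X m :
  w <= w' -> partial_clique w X m -> partial_clique w' X m.
Proof.
move=> ww [b [P [W [h1 h2 h3]]]]; exists b, P, W; split=> //.
by rewrite (leq_trans h2) // leq_mul2r ww orbT.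
Qed.

Variable D : nat.
Hypotheses (degD : forall x, #|e x| <= D) (D_gt0 : 0 < D).

(** With [Y1 = q * Y], at least [#|T| ^ 2 / Y1] pairs in [W] are joined, and at most half of these
    are dangerous. By averaging, some [x] in [W] has at least [#|T| / (2 * Y1)] suitable partners.
    Discarding those near a used vertex and those in conflict costs at most [#|T| / (8 * Y1)]
    each. *)
Lemma next_vertex t m w X q Y : m < t ->
  (forall W : {set T}, #|T| <= w * #|W| -> #|T| * D ^ k <=
     Y * #|[set z : T * T | [&& z.1 \in W, z.2 \in W & joined e l z.1 z.2]]|) ->
  #|T| <= q * D ^ k ->
  2 * X * (k * k * k) * Y * Y * (q * Y) <= D ->
  (t + t * t * k) * k * Y * (8 * (q * Y)) <= D ->
  8 * (q * Y) * t <= X ->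
  partial_clique w X m -> partial_clique (8 * (q * Y)) X m.+1.
Proof.
move=> mt many Nq XD UD tX [b [P [W [clique WN inv]]]].
set Y1 := q * Y in XD UD tX *.
have N0 : 0 < #|T| by apply/card_gt0P; exists x0.
have W0 : 0 < #|W| by move: (leq_trans N0 WN); rewrite muln_gt0 => /andP[].
pose pairs := [set z : T * T | [&& z.1 \in W, z.2 \in W & joined e l z.1 z.2]].
have PN := many W WN; rewrite -/pairs in PN.
have DkN : D ^ k <= Y * #|T|.
  rewrite -(leq_pmul2l N0) (leq_trans PN) // mulnCA leq_mul2l -card_prod.
  by rewrite max_card orbT.
have NP : #|T| * #|T| <= Y1 * #|pairs|.
  rewrite /Y1 -mulnA (leq_trans (leq_mul (leqnn _) Nq)) // mulnCA leq_mul2l PN orbT //.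
pose dang := [set z : T * T | dangerous e l X z.1 z.2].
have dangP : 2 * #|dang| <= #|pairs|.
  rewrite -(leq_pmul2l D_gt0).
  have := few_dangerous e_sym l degD D_gt0 X; rewrite -/k -/dang => fd.
  have Dk2 : D * D ^ (k + k).-1 <= Y * Y * (#|T| * #|T|).
    have -> : D * D ^ (k + k).-1 = D ^ k * D ^ k.
      by rewrite -expnD -expnS prednK // addn_gt0 k_gt0.
    by rewrite [Y * Y * _]mulnACA leq_mul.
  apply: (@leq_trans (2 * X * (k * k * k) * (D * D ^ (k + k).-1))).
    have -> : 2 * X * (k * k * k) * (D * D ^ (k + k).-1) =
      D * (2 * (X * (k * k * k * D ^ (k + k).-1))) by rewrite mulnCA !mulnA.
    by rewrite !leq_mul2l fd !orbT.
  apply: (@leq_trans (2 * X * (k * k * k) * (Y * Y * (Y1 * #|pairs|)))).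
    by rewrite leq_mul2l (leq_trans Dk2) ?orbT // leq_mul2l NP orbT.
  by rewrite !mulnA leq_mul2r -!mulnA; move: XD; rewrite -!mulnA => ->; rewrite orbT.
pose nb x := [set y in W | joined e l x y && ~~ dangerous e l X x y].
have [x xW xnb] : exists2 x, x \in W & #|pairs| <= 2 * #|T| * #|nb x|.
  apply/exists_inP; apply: contraT => /exists_inPn none.
  have lt : \sum_(x in W) 2 * #|T| * #|nb x| < #|T| * #|pairs|.
    apply: (@leq_trans (#|W| * #|pairs|)); last by rewrite leq_mul2r max_card orbT.
    rewrite -sum_nat_const.
    apply: (@leq_trans (\sum_(x in W) (2 * #|T| * #|nb x|).+1)).
      under [ltnRHS]eq_bigr do rewrite -addn1.
      by rewrite big_split sum1_card /= -[ltnLHS]addn0 ltn_add2l.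
    by apply: leq_sum => x /none; rewrite -ltnNge.
  have ge : #|pairs| <= #|dang| + \sum_(x in W) #|nb x|.
    have -> : \sum_(x in W) #|nb x| = #|pairs :\: dang|.
      rewrite -[RHS]sum1_card [RHS]big_mkcond /=.
      rewrite [RHS](eq_bigr (fun z => (z.1 \in W) * (z.2 \in nb z.1))); last first.
        move=> -[x y] _; rewrite /pairs /dang /nb !inE /=.
        case: (x \in W); rewrite ?andbF //=.
        by case: (y \in W); case: (joined e l x y); case: (dangerous e l X x y).
      rewrite -(pair_bigA _ (fun x y => (x \in W) * (y \in nb x))) [LHS]big_mkcond /=.
      apply: eq_bigr => x _; rewrite -big_distrr /=; case: (x \in W); last by rewrite mul0n.
      by rewrite mul1n -sum1_card big_mkcond.
    rewrite -[leqLHS](cardsID dang) leq_add2r subset_leq_card //.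
    exact: subsetIr.
  have {lt} : 2 * #|T| * \sum_(x in W) #|nb x| < #|T| * #|pairs| by rewrite big_distrr.
  rewrite -mulnA mulnCA ltn_pmul2l //.
  by move: dangP ge; move: (\sum_(_ in _) _) #|dang| #|pairs| => s1 s2 s3; clear; lia.
have [jo ndang nconf far] := inv x xW.
have [P' clique'] := extend_clique clique jo nconf far.
set b' := (fun i => _) in clique'.
have b'm : b' m = x by rewrite /b' eqxx.
have b'i i : i < m -> b' i = b i by move=> im; rewrite /b' (ltn_eqF im).
pose near := [set y | has (fun u => has (fun n => reach e n u y) (iota 0 k)) (usedb m.+1 b' P')].
pose conf := [set y | has (fun i => conflict e l (b i) x y) (iota 0 m)].
pose W' := nb x :\: (near :|: conf).
(* Each of the boundedly many used vertices is near at most [k * D ^ k.-1] vertices, while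
   [D ^ k <= Y * #|T|]. *)
have nearN : 8 * Y1 * #|near| <= #|T|.
  have su : size (usedb m.+1 b' P') <= t + t * t * k.
    have [_ P1 _] := clique'.
    rewrite /usedb (size_used (l := l)); last first.
      by move=> z; rewrite mem_pairs_below => /P1[].
    apply: leq_add => //; apply: leq_mul; last exact: leq_pred.
    by rewrite (leq_trans (size_pairs_below _)) // leq_mul.
  have nearD : #|near| <= (t + t * t * k) * (k * D ^ k.-1).
    apply: leq_trans (leq_mul su (leqnn _)).
    apply: card_has_le => u _; rewrite -{2}[k](size_iota 0); apply: card_has_le => n.
    rewrite mem_iota => /= nk; rewrite (leq_trans (card_reach degD n u)) // leq_pexp2l //.
    by rewrite -ltnS prednK.
  rewrite -(leq_pmul2l D_gt0).
  apply: (@leq_trans (8 * Y1 * ((t + t * t * k) * (k * D ^ k)))).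
    rewrite mulnCA leq_mul2l -[in D ^ k](prednK k_gt0) expnS.
    have -> : (t + t * t * k) * (k * (D * D ^ k.-1)) = D * ((t + t * t * k) * (k * D ^ k.-1)).
      by rewrite [RHS]mulnCA; congr muln; rewrite mulnCA.
    by rewrite leq_mul2l nearD !orbT.
  apply: (@leq_trans ((t + t * t * k) * k * Y * (8 * Y1) * #|T|)); last by rewrite leq_mul2r UD orbT.
  have gen c c' k' Dk n : Dk <= Y * n ->
      8 * c' * (c * (k' * Dk)) <= c * k' * Y * (8 * c') * n.
    have -> : 8 * c' * (c * (k' * Dk)) = c * k' * (8 * c') * Dk by clear; lia.
    have -> : c * k' * Y * (8 * c') * n = c * k' * (8 * c') * (Y * n) by clear; lia.
    by move=> le; rewrite leq_mul2l le orbT.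
  exact: gen.
(* As [x] was in [W], no pair of [b i] and [x] is dangerous, so each excludes at most [#|T| / X]
   vertices. *)
have confN : 8 * Y1 * #|conf| <= #|T|.
  have [m0|m0] := posnP m.
    by rewrite /conf m0 (_ : [set y | _] = set0) ?cards0 ?muln0 //; apply/setP => y; rewrite !inE.
  pose c := \max_(i < m) #|[set y | conflict e l (b i) x y]|.
  have confc : #|conf| <= m * c.
    rewrite -{1}[m](size_iota 0); apply: card_has_le => i; rewrite mem_iota => /= im.
    exact: (leq_bigmax (F := fun i : 'I_m => #|[set y | conflict e l (b i) x y]|) (Ordinal im)).
  have [i ci] : exists i : 'I_m, c = #|[set y | conflict e l (b i) x y]|.
    have Im : 0 < #|'I_m| by rewrite card_ord.
    have [i ci] := eq_bigmax (fun i : 'I_m => #|[set y | conflict e l (b i) x y]|) Im.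
    by exists i.
  have XcN : X * c <= #|T| by have := ndang i (ltn_ord i); rewrite /dangerous -leqNgt ci.
  apply: leq_trans XcN; apply: (@leq_trans (8 * Y1 * t * c)); last by rewrite leq_mul2r tX orbT.
  by rewrite -[leqRHS]mulnA leq_mul2l (leq_trans confc) ?orbT // leq_mul2r (ltnW mt) orbT.
exists b', P', W'; split=> //.
  have NY : #|T| <= 2 * Y1 * #|nb x|.
    rewrite -(leq_pmul2l N0) (leq_trans NP) //.
    rewrite (leq_trans (leq_mul (leqnn Y1) xnb)) //.
    by apply: eq_leq; move: #|T| #|nb x| => n1 n2; clear; lia.
  have W'ge : #|nb x| <= #|W'| + (#|near| + #|conf|).
    rewrite -(cardsID (near :|: conf) (nb x)) addnC leq_add2l.
    rewrite (leq_trans (subset_leq_card (subsetIr _ _))) // cardsU leq_subr //.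
  have := leq_mul (leqnn (8 * Y1)) W'ge; rewrite !mulnDr => W'ge'.
  move: NY nearN confN W'ge'; rewrite -!mulnA.
  move: (Y1 * #|nb x|) (Y1 * #|near|) (Y1 * #|conf|) (Y1 * #|W'|) #|T|.
  by move=> n1 n2 n3 n4 n5; clear; lia.
move=> y; rewrite !inE negb_or => /andP[/andP[ynear yconf] /and3P[yW xy ndxy]].
have [jo' ndang' nconf' _] := inv y yW; split.
- move=> i; rewrite ltnS leq_eqVlt => /predU1P[->|im]; first by rewrite b'm.
  by rewrite b'i //; apply: jo'.
- move=> i; rewrite ltnS leq_eqVlt => /predU1P[->|im]; first by rewrite b'm.
  by rewrite b'i //; apply: ndang'.
- move=> i j /andP[ij]; rewrite ltnS leq_eqVlt => /predU1P[jm|jm].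
    rewrite jm in ij *; rewrite b'm b'i //.
    by apply: contra yconf => h; apply/hasP; exists i; rewrite ?mem_iota.
  by rewrite !b'i ?(ltn_trans ij) //; apply: nconf'; rewrite ij.
move=> u uU n nk; apply: contra ynear => h; apply/hasP; exists u => //.
by apply/hasP; exists n; rewrite ?mem_iota.
Qed.

End Picking.

Lemma regular_graph_le B B' q d D k (T : finType) (e : rel T) :
  B' <= B -> 0 < q -> regular_graph B q d D k e -> regular_graph B' q d D k e.
Proof.
move=> BB q0 [h1 h2 h3 h4 h5]; split=> //; first exact: leq_trans h1.
by apply: leq_trans h2; rewrite leq_pexp2l.
Qed.

(** A linked clique is subdivided greedily; in its absence [next_vertex] is iterated [t] times. *)
Lemma subdivided_clique_regular t l : 0 < l -> exists B,
  forall (T : finType) (e : rel T) (x0 : T) q d D,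
  symmetric e -> irreflexive e -> regular_graph B q d D (l + l) e ->
  exists b P, subdivided_clique e l t b P.
Proof.
move=> l0; pose k := l + l; pose C := t + t * t * k.
have [R ramseyR] := ramsey (fun _ : 'I_l => t) l0.
(* The threshold [q ^ g] for danger is common to all the steps and must exceed the losses [q ^ w] of
   all of them, so [g] comes after [w]; [B] depends on both. *)
suff claim m : m <= t -> exists w, forall g, w <= g -> exists B,
    forall (T : finType) (e : rel T) (x0 : T) q d D,
    symmetric e -> irreflexive e -> regular_graph B q d D k e ->
    ~ linked_clique e C l t -> partial_clique e l (q ^ w) (q ^ g) m.
  have [w /(_ _ (leqnn w))[B hB]] := claim t (leqnn t).
  exists B => T e x0 q d D e_sym e_irr reg.
  have [cl|ncl] := boolp.EM (linked_clique e C l t).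
    exact: linked_clique_subdivided cl.
  by have [b [P [W [cl _ _]]]] := hB T e x0 q d D e_sym e_irr reg ncl; exists b, P.
elim: m => [_|m IHm mt].
  exists 0 => g _; exists 0 => T e x0 q d D _ _ _ _.
  by rewrite expn0; apply: partial_clique0.
have [w hw] := IHm (ltnW mt).
have [w' [B1 hB1]] := @many_joined C t l w R l0 ramseyR.
exists (w + w' + 2) => g wg.
have [|B2 hB2] := hw g; first by apply: leq_trans wg; rewrite -addnA leq_addr.
pose U := (t + t * t * k) * k.
exists (B1 + B2 + (8 * t.+1) + (2 * (k * k * k)) + U * 8 + (g + 3 * w' + 2)).
move=> T e x0 q d D e_sym e_irr reg ncl.
set B := B1 + _ + _ + _ + _ + _ in reg.
have [Bq qd degs Dqd Nd] := reg.
have [B1B B2B gB] : [/\ B1 <= B, B2 <= B & g + 3 * w' + 2 <= B].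
  by rewrite /B; move: (8 * _) (2 * _) (U * 8) => c1 c2 c3; clear; split; lia.
have [tq kq Uq] : [/\ 8 * t.+1 <= q, 2 * (k * k * k) <= q & U * 8 <= q].
  move: Bq; rewrite /B; move: (8 * _) (2 * _) (U * 8) => c1 c2 c3; clear => h.
  by split; lia.
have q0 : 0 < q by apply: leq_trans tq; rewrite muln_gt0.
have degD x : #|e x| <= D by have /andP[] := degs x.
have dD : d <= D by have /andP[] := degs x0; apply: leq_trans.
have qD c : c <= g + 3 * w' + 2 -> q ^ c <= D.
  move=> cB; apply: leq_trans dD; apply: leq_trans qd; rewrite leq_pexp2l //.
  exact: leq_trans gB.
have D0 : 0 < D by apply: leq_trans (qD 0 _).
have part := hB2 T e x0 q d D e_sym e_irr (regular_graph_le B2B q0 reg) ncl.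
have many := hB1 T e x0 q d D e_sym e_irr (regular_graph_le B1B q0 reg) ncl.
have := @next_vertex T e x0 e_sym l l0 D degD D0 t m (q ^ w) (q ^ g) q (q ^ w') mt many.
rewrite -/k -expnS => next; apply: (@partial_clique_weaken _ _ _ (8 * q ^ w'.+1)).
  rewrite mulnC; apply: (@expn_mul_le _ w'.+1) => //; last by clear; lia.
  by apply: leq_trans tq; rewrite leq_pmulr.
apply: next part.
- by rewrite (leq_trans Nd) // leq_mul2l leq_exp2r ?dD ?orbT // addn_gt0 l0.
- apply: leq_trans (qD (g + 3 * w' + 2) _) => //.
  have -> : 2 * q ^ g * (k * k * k) * q ^ w' * q ^ w' * q ^ w'.+1 =
      q ^ (g + 3 * w' + 1) * (2 * (k * k * k)).
    have -> : g + 3 * w' + 1 = g + w' + w' + w'.+1 by clear; lia.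
    rewrite !expnD.
    by move: (q ^ g) (q ^ w') (q ^ w'.+1) (k * k * k) => a1 a2 a3 a4; clear; lia.
  by apply: (expn_mul_le kq (leqnn _)); clear; lia.
- apply: leq_trans (qD (2 * w' + 2) _); last by clear; lia.
  have -> : (t + t * t * k) * k * q ^ w' * (8 * q ^ w'.+1) = q ^ (2 * w' + 1) * (U * 8).
    have -> : 2 * w' + 1 = w' + w'.+1 by clear; lia.
    by rewrite expnD /U; move: (q ^ w') (q ^ w'.+1) ((t + _) * k) => a1 a2 a3; clear; lia.
  by apply: (expn_mul_le Uq (leqnn _)); clear; lia.
have -> : 8 * q ^ w'.+1 * t = q ^ w'.+1 * (8 * t) by rewrite mulnAC mulnC.
apply: (@leq_trans (q ^ w'.+2)); last by rewrite leq_pexp2l //; move: wg; clear; lia.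
apply: (expn_mul_le _ (leqnn _)) => //; apply: leq_trans tq.
by rewrite leq_mul2l /=.
Qed.

(** * Regularisation *)

Section Regularisation.

Variables (V : finType) (e : rel V).
Hypotheses (e_sym : symmetric e) (e_irr : irreflexive e).
Implicit Types (S A U : {set V}) (u v : V).

Definition degree_in S u := \sum_(v in S) e u v.
(** Ordered pairs: twice the number of edges inside [S]. *)
Definition inner_pairs S := \sum_(u in S) degree_in S u.

Lemma degree_in_le S S' u : S \subset S' -> degree_in S u <= degree_in S' u.
Proof.
move=> SS; rewrite /degree_in [leqRHS](bigID (mem S)) /=.
rewrite (leq_trans _ (leq_addr _ _)) // [leqRHS](eq_bigl (fun v => v \in S)) // => v.
by rewrite andbC; case: (boolP (v \in S)) => // /(subsetP SS) ->.
Qed.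

Lemma inner_pairs_le S : inner_pairs S <= #|S| ^ 2.
Proof.
rewrite expnS expn1 -sum_nat_const; apply: leq_sum => u _.
by rewrite -sum1_card; apply: leq_sum => v _; case: e.
Qed.

Lemma inner_pairs_setD S A :
  inner_pairs S <= inner_pairs (S :\: A) + 2 * \sum_(u in A) degree_in S u.
Proof.
rewrite {1}/inner_pairs (bigID (mem A)) addnC /=.
rewrite mul2n -addnn -addnA; apply: leq_add.
  rewrite big_mkcond [leqRHS]big_mkcond leq_sum // => u _.
  by case: (u \in S); case: (u \in A).
rewrite (eq_bigl (fun u => u \in S :\: A)) => [|u]; last by rewrite inE andbC.
rewrite (eq_bigr (fun u => degree_in (S :\: A) u + \sum_(v in S | v \in A) e u v)); last first.
  move=> u _; rewrite {1}/degree_in (bigID (mem A)) addnC /=; congr (_ + _).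
  by apply: eq_bigl => v; rewrite inE andbC.
rewrite big_split /= addnC; apply: leq_add => //; rewrite exchange_big /=.
rewrite big_mkcond [leqRHS]big_mkcond leq_sum // => v _; rewrite andbC.
case: (v \in A) => //=; case: (v \in S) => //.
rewrite /degree_in big_mkcond [leqRHS]big_mkcond leq_sum // => u _; rewrite inE e_sym.
by case: (u \in A); case: (u \in S).
Qed.

(** Take a smallest [U] with [c * #|U| <= c' * inner_pairs U]. Deleting [v] breaks this inequality,
    so more than [c / c'] pairs are lost, and these are at most twice the degree of [v]. *)
Lemma min_degree_core S c c' : S != set0 -> 0 < c -> c * #|S| <= c' * inner_pairs S ->
  exists U, [/\ U \subset S, U != set0 & forall v, v \in U -> c <= 2 * c' * degree_in U v].
Proof.
move=> S0 c0 dense.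
pose P U := [&& U \subset S, U != set0 & c * #|U| <= c' * inner_pairs U].
have PS : P S by rewrite /P subxx S0.
have [U /and3P[US U0 Ud] Umin] := arg_minnP (fun U : {set V} => #|U|) PS.
exists U; split=> // v vU.
have step := inner_pairs_setD U [set v]; rewrite big_set1 in step.
have cU : #|U| = #|U :\ v|.+1 by rewrite (cardsD1 v U) vU.
have [E|ne] := eqVneq (U :\ v) set0.
  have i0 : inner_pairs (U :\ v) = 0 by rewrite E /inner_pairs big_set0.
  rewrite i0 add0n in step; rewrite E cards0 in cU.
  apply: leq_trans (leq_trans _ Ud) _; first by rewrite cU muln1.
  by rewrite -mulnA mulnCA leq_mul2l step orbT.
have nP : ~~ P (U :\ v).
  by apply/negP => /Umin; rewrite cU ltnn.
have {nP} lt : c' * inner_pairs (U :\ v) < c * #|U :\ v|.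
  move: nP; rewrite /P ne (subset_trans (subsetDl _ _) US) /=.
  by rewrite -ltnNge.
have := leq_mul (leqnn c') step; rewrite mulnDr => /(leq_trans Ud).
rewrite cU mulnS; have -> : 2 * c' * degree_in U v = c' * (2 * degree_in U v) by clear; lia.
by move: lt; move: (c' * inner_pairs _) (c * _) (c' * (_ * _)) => a1 a2 a3; clear; lia.
Qed.

(** Blocks are the residue classes modulo [q] of the indices in [enum S]; a pair from [A] to [S]
    lies in [A :|: B i] for the block of its second entry. *)
Lemma blocks_cover S A q : 0 < q -> exists B : 'I_q -> {set V},
  (forall i, #|B i| * q <= #|S| + q) /\
  \sum_(u in A) degree_in S u <= \sum_(i < q) inner_pairs (A :|: B i).
Proof.
move=> q0.
pose B (i : 'I_q) := [set v in S | index v (enum S) %% q == i].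
exists B; split=> [i|].
  have inj : {in B i &, injective (fun v => inord (index v (enum S) %/ q) : 'I_(#|S| %/ q).+1)}.
    move=> u v; rewrite !inE => /andP[uS /eqP ui] /andP[vS /eqP vi] /(congr1 val) /=.
    have lt x : x \in S -> index x (enum S) %/ q < (#|S| %/ q).+1.
      by move=> xS; rewrite ltnS leq_div2r // ltnW // cardE index_mem mem_enum.
    rewrite !inordK ?lt // => E.
    have EE : index u (enum S) = index v (enum S).
      by rewrite (divn_eq (index u _) q) (divn_eq (index v _) q) E ui vi.
    by rewrite -(nth_index u (s := enum S) (x := u)) ?mem_enum // EE nth_index ?mem_enum.
  rewrite -(card_in_imset inj); apply: (@leq_trans ((#|S| %/ q).+1 * q)).
    by rewrite leq_mul2r (leq_trans (max_card _)) ?card_ord ?orbT.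
  by rewrite mulSn addnC leq_add2r leq_divM.
rewrite (eq_bigr (fun u => \sum_(i < q) \sum_(v in B i) e u v)); last first.
  move=> u _; pose p v := Ordinal (ltn_pmod (index v (enum S)) q0).
  rewrite /degree_in (partition_big p xpredT) //=; apply: eq_bigr => i _.
  by apply: eq_bigl => v; rewrite inE.
rewrite exchange_big /=; apply: leq_sum => i _; rewrite /inner_pairs.
rewrite [leqLHS]big_mkcond [leqRHS]big_mkcond; apply: leq_sum => u _; rewrite in_setU.
case: (u \in A) => //=; rewrite /degree_in.
rewrite [leqLHS]big_mkcond [leqRHS]big_mkcond; apply: leq_sum => v _; rewrite in_setU.
by case: (v \in B i); case: (v \in A).
Qed.

(** The vertices of degree above [q] times the average form a set [A] of at most [#|S| / q]
    elements. Each [A :|: B i] is small, hence sparse, so the degrees in [A] sum to at most a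
    quarter of the pairs. Half of the pairs survive without [A], and [min_degree_core] applies
    there. *)
Lemma almost_regular_core S q :
  0 < q <= #|S| -> 0 < inner_pairs S ->
  (forall S', #|S'| * q <= 3 * #|S| -> 4 * q * inner_pairs S' <= inner_pairs S) ->
  exists U, [/\ U \subset S, U != set0 & forall v, v \in U ->
    inner_pairs S <= 4 * #|S| * degree_in U v /\
    degree_in U v * #|S| <= q * inner_pairs S].
Proof.
move=> /andP[q0 qS] E0 sparse; set E := inner_pairs S in E0 sparse *.
pose A := [set v in S | q * E < #|S| * degree_in S v].
have Aq : #|A| * q <= #|S|.
  rewrite -(leq_pmul2r E0) -mulnA.
  apply: (@leq_trans (#|S| * \sum_(v in A) degree_in S v)).
    rewrite [leqRHS]big_distrr -sum_nat_const /=; apply: leq_sum => v.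
    by rewrite inE => /andP[_ /ltnW].
  rewrite leq_mul2l /E /inner_pairs; apply/orP; right.
  rewrite [leqLHS]big_mkcond [leqRHS]big_mkcond /=; apply: leq_sum => v _; rewrite inE.
  by case: (v \in S) => //=; case: (_ < _).
have [B [Bq cover]] := blocks_cover S A q0.
have A4 : 4 * \sum_(u in A) degree_in S u <= E.
  rewrite -(leq_pmul2l q0) (leq_trans (leq_mul (leqnn q) (leq_mul (leqnn 4) cover))) //.
  rewrite mulnA [q * 4]mulnC big_distrr /= -[q in leqRHS]card_ord -sum_nat_const leq_sum //.
  move=> i _; apply: sparse.
  apply: (@leq_trans ((#|A| + #|B i|) * q)).
    by rewrite leq_mul2r leq_card_setU orbT.
  rewrite mulnDl; have := Bq i; move: Aq qS.
  by move: (#|A| * q) (#|B i| * q) #|S| => a1 a2 a3; clear; lia.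
have SA : E <= 2 * inner_pairs (S :\: A).
  move: (inner_pairs_setD S A) A4; rewrite -/E.
  by move: (inner_pairs _) (\sum_(_ in _) _) => a1 a2; clear; lia.
have SA0 : S :\: A != set0.
  by apply: contraTneq E0 => E'; move: SA; rewrite E' /inner_pairs big_set0 muln0 -leqNgt.
have dense : E * #|S :\: A| <= 2 * #|S| * inner_pairs (S :\: A).
  rewrite mulnAC; apply: leq_mul => //; exact: subset_leq_card (subsetDl _ _).
have [U [UA U0 Udeg]] := min_degree_core SA0 E0 dense.
have US : U \subset S := subset_trans UA (subsetDl _ _).
exists U; split=> // v vU; split; first by rewrite (leq_trans (Udeg v vU)) // mulnA.
have : v \in S :\: A by apply: (subsetP UA).
rewrite !inE => /andP[+ vS]; rewrite vS /= -leqNgt; apply: leq_trans.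
by rewrite mulnC leq_mul2l degree_in_le ?orbT.
Qed.

End Regularisation.

(** In the graph induced on [U] the degrees lie between a quarter of the average in [S] and [q]
    times this average. Using [q ^ 2] as the regularity factor absorbs the 4 and the rounding. *)
Lemma clique_from_core t l (V : finType) (e : rel V) B (S U : {set V}) q :
  symmetric e -> irreflexive e ->
  (forall (T : finType) (e : rel T) (x0 : T) q d D,
    symmetric e -> irreflexive e -> regular_graph B q d D (l + l) e ->
    exists b P, subdivided_clique e l t b P) ->
  let d := inner_pairs e S %/ (4 * #|S|) in
  B <= q -> 8 <= q -> 0 < d -> (q ^ 2) ^ B <= d -> #|S| <= q ^ 2 * d ^ (l + l) ->
  U \subset S -> U != set0 ->
  (forall v, v \in U -> inner_pairs e S <= 4 * #|S| * degree_in e U v /\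
    degree_in e U v * #|S| <= q * inner_pairs e S) ->
  exists b P, subdivided_clique e l t b P.
Proof.
move=> e_sym e_irr core d Bq q8 d0 qd Sd US /set0Pn[u0 u0U] degs.
have S0 : 0 < #|S| by apply/card_gt0P; exists u0; apply: (subsetP US).
pose T := {v | v \in U}; pose eT : rel T := fun x y => e (val x) (val y).
have degT (x : T) : #|eT x| = degree_in e U (val x).
  rewrite -(card_imset _ val_inj) /degree_in -sum1_card big_mkcond [RHS]big_mkcond /=.
  apply: eq_bigr => v _; case: imsetP => [[y xy ->]|none].
    by rewrite (valP y) /=; move: xy; rewrite -topredE /= /eT => ->.
  case: ifP => // vU; case: (boolP (e (val x) v)) => // xv.
  by case: none; exists (exist _ v vU).
have [b [P clique]] : exists b P, subdivided_clique eT l t b P.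
  apply: (core T eT (exist _ u0 u0U) (q ^ 2) d (q * inner_pairs e S %/ #|S|)).
  - by move=> x y; apply: e_sym.
  - by move=> x; apply: e_irr.
  split=> //.
  - by rewrite (leq_trans Bq) // expnS expn1 leq_pmulr // (leq_trans _ q8).
  - move=> x; rewrite degT; have [h1 h2] := degs _ (valP x).
    rewrite /d leq_divRL // h2 andbT -(leq_pmul2l (_ : 0 < 4 * #|S|)) ?muln_gt0 //.
    by rewrite (leq_trans _ h1) // mulnC leq_divM.
  - rewrite -ltnS ltn_divLR //.
    have lt : inner_pairs e S < 4 * #|S| * d.+1.
      by rewrite mulnC -ltn_divLR // muln_gt0.
    apply: (@leq_trans (q * (4 * #|S| * d.+1))).
      by rewrite ltn_pmul2l // (leq_trans _ q8).
    apply: (@leq_trans (q ^ 2 * d * #|S|)); last by rewrite leq_mul2r leqnSn orbT.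
    have -> : q ^ 2 * d * #|S| = q * (q * d * #|S|) by rewrite expnS expn1 !mulnA.
    rewrite leq_mul2l [4 * _]mulnC -mulnA [leqRHS]mulnC leq_mul2l; apply/orP; right.
    apply/orP; right; apply: (@leq_trans (8 * d)); last by rewrite leq_mul2r q8 orbT.
    by move: d0; move: (d) => d'; clear; lia.
  by rewrite card_sig (leq_trans _ Sd) // subset_leq_card.
exists (val \o b), (fun z => map val (P z)).
have [h1 h2 h3] := clique; split.
- by move=> i j it jt /val_inj; apply: h1.
- move=> z zt; have [g1 g2 g3 g4] := h2 z zt; split.
  + by rewrite size_map.
  + by rewrite /= -map_rcons path_map.
  + by rewrite map_inj_uniq //; apply: val_inj.
  + by move=> i it; rewrite /= mem_map ?g4 //; apply: val_inj.
move=> z z' x zt zt' /mapP[y yP ->] /mapP[y' yP' /val_inj E].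
by apply: (h3 z z' y) => //; rewrite E.
Qed.

(** * Graphs *)

Section Graphs.

Variables (W : finType) (G : sgraph W).

Lemma adj_sym : symmetric (adj G).
Proof. by move=> x y; rewrite /adj setUC. Qed.

Lemma card_edge A : A \in edges G -> #|A| = 2.
Proof. by have /forall_inP h := edgesP G => /h /eqP. Qed.

Lemma adj_irr : irreflexive (adj G).
Proof.
by move=> x; apply/negP => /card_edge; rewrite setUid cards1.
Qed.

Lemma card_edges_le : #|edges G| <= inner_pairs (adj G) setT.
Proof.
have -> : inner_pairs (adj G) setT = #|[set z : W * W | adj G z.1 z.2]|.
  rewrite /inner_pairs /degree_in -sum1_card [RHS]big_mkcond /=.
  rewrite (eq_bigl xpredT) => [|u]; last by rewrite inE.
  rewrite (eq_bigr (fun u => \sum_v adj G u v)) => [|u _]; last first.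
    by apply: eq_bigl => v; rewrite inE.
  by rewrite pair_bigA; apply: eq_bigr => -[u v] _; rewrite inE.
apply: leq_trans (leq_imset_card (fun z : W * W => [set z.1; z.2]) _).
apply: subset_leq_card; apply/subsetP => A AG.
have /eqP/cards2P[x [y [_ AE]]] := card_edge AG.
have xyG : (x, y) \in [set z : W * W | adj G z.1 z.2] by rewrite inE /adj /= -AE.
by rewrite AE; exact: (imset_f (fun z : W * W => [set z.1; z.2]) xyG).
Qed.

(** A vertex of [F] goes to the branch vertex indexed by its rank. Ranks increase along an oriented
    edge, so its new vertices fill the path of a pair of the clique. *)
Lemma subdivided_clique_copy (V : finType) (F : sgraph V) k l b P :
  0 < k -> k = l + l -> subdivided_clique (adj G) l #|V| b P ->
  contains_copy G (subdivision F k.-1).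
Proof.
move=> k0 kl [bI P1 P2].
pose x0 := b 0.
pose rk (v : V) : nat := enum_rank v.
pose z (a : oriented_edge F) := (rk (val a).1, rk (val a).2).
have zV a : (z a).1 < (z a).2 < #|V|.
  by have /andP[_ lt] := valP a; rewrite /z /= /rk lt ltn_ord.
have sizeP a : size (P (z a)) = k.-1 by rewrite kl; have [] := P1 _ (zV a).
pose f (s : subdiv_vertex F k.-1) : W :=
  match s with inl v => b (rk v) | inr ai => nth x0 (P (z ai.1)) ai.2 end.
have rk_inj u v : rk u = rk v -> u = v by move=> /val_inj /enum_rank_inj.
have z_inj a a' : z a = z a' -> a = a'.
  by move=> [/rk_inj E1 /rk_inj E2]; apply: val_inj; rewrite [val a]surjective_pairing E1 E2 -surjective_pairing.
have f_inj : injective f.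
  move=> [u|[a i]] [v|[a' i']] /=.
  - by move=> E; congr inl; apply: rk_inj; apply: bI E; apply: ltn_ord.
  - move=> E; have [_ _ _ /(_ _ (ltn_ord (enum_rank u)))] := P1 _ (zV a').
    by rewrite -/(rk u) E mem_nth // sizeP.
  - move=> E; have [_ _ _ /(_ _ (ltn_ord (enum_rank v)))] := P1 _ (zV a).
    by rewrite -/(rk v) -E mem_nth // sizeP.
  move=> E; have zz : z a = z a'.
    apply: (P2 _ _ (nth x0 (P (z a)) i)) => //; first by rewrite mem_nth ?sizeP.
    by rewrite E mem_nth ?sizeP.
  have aa := z_inj _ _ zz; rewrite -aa in E *.
  have [_ _ PU _] := P1 _ (zV a).
  by move/eqP: E; rewrite nth_uniq ?sizeP // => /eqP /val_inj ->.
have f_point a j : j <= k ->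
    f (subdiv_point k.-1 a j) = nth x0 (b (z a).1 :: rcons (P (z a)) (b (z a).2)) j.
  case: j => // j jk /=; rewrite nth_rcons sizeP; case: insubP => [i ji ij|nj] /=.
    by rewrite -ij ltn_ord.
  by rewrite (negbTE nj) ifT //; apply/eqP; lia.
apply/existsP; exists (finfun f); apply/andP; split.
  by apply/injectiveP => u v; rewrite !ffunE; apply: f_inj.
apply/forallP => x; apply/forallP => y; apply/implyP; rewrite !ffunE.
move=> /imset2P[a j _ _ xyE].
have -> : adj G (f x) (f y) = (f @: [set x; y] \in edges G).
  by rewrite /adj imsetU !imset_set1.
rewrite xyE imsetU !imset_set1.
have jk : j < k by apply: leq_trans (ltn_ord j) _; rewrite prednK.
rewrite !f_point //; last exact: ltnW.
have [_ /(pathP x0) h _ _] := P1 _ (zV a).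
by apply: h; rewrite size_rcons sizeP; apply: ltn_ord.
Qed.

End Graphs.

(** * The extremal number *)

From mathcomp Require Import all_order all_algebra.
From mathcomp Require Import all_classical all_reals all_analysis.
From mathcomp Require Import ring lra.
Import Order.TTheory GRing.Theory Num.Theory.
Import numFieldNormedType.Exports.
Local Open Scope classical_set_scope.
Local Open Scope ring_scope.

Unset Implicit Arguments.
Set Strict Implicit.

(* x ^ (k a) is the number of vertices of a densest subset S, C x ^ (k a + a - 1) bounds
   its number of edges from below, and q is the integer part of x ^ k. *)
Lemma densest_numerics (R : realType) (k a B Q s : nat) (E : nat) (x C : R) :
  (2 <= k)%N -> a = (2 * k * B.+1).+1 -> (0 < s)%N -> 1 <= x ->
  x ^+ (k * a) = s%:R -> C = ((Q + 8) ^ (k * a))%:R ->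
  C * x ^+ (k * a + a.-1) < E%:R -> (E <= s ^ 2)%N ->
  let q := Num.truncn (x ^+ k) in
  [/\ (Q <= q)%N, (0 < q <= s)%N, (0 < E %/ (4 * s))%N,
      ((q ^ 2) ^ B.+1 <= E %/ (4 * s))%N & (s <= q ^ 2 * (E %/ (4 * s)) ^ k)%N].
Proof.
move=> k2 aE s0 x1 xs CE CE' Es q.
have x0 : 0 < x by apply: lt_le_trans x1.
have xk0 : 0 <= x ^+ k by rewrite exprn_ge0 // ltW.
have qle : q%:R <= x ^+ k by rewrite truncn_le.
have qgt : x ^+ k < q.+1%:R by apply: truncnS_gt.
have a0 : (0 < a)%N by rewrite aE.
have C8 : 8 <= C.
  rewrite CE ler_nat; apply: (@leq_trans ((Q + 8) ^ 1)); first by rewrite expn1 leq_addl.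
  by rewrite leq_pexp2l // ?addn_gt0 ?orbT // muln_gt0 a0 (ltnW k2).
have sR : 0 < s%:R :> R by rewrite ltr0n.
(* [E <= s ^ 2] and the lower bound on [E] force [s] to exceed [C]; the shape of [C] then gives
   [Q + 8 < x]. *)
have xka : C < x ^+ (k * a).
  have : C * x ^+ (k * a + a.-1) < s%:R * s%:R.
    by rewrite -natrM mulnn (lt_le_trans CE') // ler_nat.
  rewrite -xs exprD mulrA [C * _]mulrC -mulrA ltr_pM2l ?exprn_gt0 //.
  apply: le_lt_trans; rewrite -[leLHS]mulr1 ler_wpM2l ?exprn_ege1 //.
  by apply: le_trans C8.
have ka0 : (0 < k * a)%N by rewrite muln_gt0 a0 (ltnW k2).
have Qx : (Q + 8)%:R < x.
  rewrite -(ltr_pXn2r ka0) ?nnegrE ?ler0n ?(ltW x0) //.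
  by rewrite -natrX -CE.
have Qq : (Q + 8 <= q)%N.
  rewrite -ltnS -(ltr_nat R) (lt_trans Qx) // (le_lt_trans _ qgt) //.
  by rewrite ler_eXnr // ltnW.
have qs : (q <= s)%N.
  rewrite -(ler_nat R) (le_trans qle) // -xs ler_weXn2l //.
  by rewrite leq_pmulr.
set d := (E %/ (4 * s))%N.
have s40 : (0 < 4 * s)%N by rewrite muln_gt0.
(* As [8 <= C], [d.+1] exceeds [2 * x ^+ a.-1], and half of this pays for the rounding. *)
have xd : x ^+ a.-1 <= d%:R.
  have Ed : (E < d.+1 * (4 * s))%N by rewrite -ltn_divLR.
  have xa1 : 1 <= x ^+ a.-1 by rewrite exprn_ege1.
  have : C * x ^+ a.-1 < 4 * d.+1%:R.
    rewrite -(ltr_pM2r sR).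
    have -> : C * x ^+ a.-1 * s%:R = C * x ^+ (k * a + a.-1).
      by rewrite -xs exprD -mulrA [X in C * X]mulrC.
    rewrite (lt_le_trans CE') //.
    have -> : 4 * d.+1%:R * s%:R = (d.+1 * (4 * s))%:R :> R by rewrite !natrM; lra.
    by rewrite ler_nat ltnW.
  have : 8 * x ^+ a.-1 <= C * x ^+ a.-1 by rewrite ler_wpM2r // exprn_ge0 // ltW.
  rewrite -natr1; lra.
have d0 : (0 < d)%N.
  by rewrite -(ltr0n R) (lt_le_trans _ xd) // exprn_gt0.
split=> //.
- by rewrite (leq_trans _ Qq) // leq_addr.
- by rewrite qs (leq_trans _ Qq) // addnS.
- rewrite -(ler_nat R) (le_trans _ xd) // -expnM natrX aE /=.
  have -> : x ^+ (2 * k * B.+1) = (x ^+ k) ^+ (2 * B.+1).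
    by rewrite -exprM; congr (_ ^+ _); rewrite mulnCA mulnA.
  by rewrite lerXn2r ?nnegrE ?ler0n.
rewrite -(ler_nat R) -xs natrM natrX.
have -> : x ^+ (k * a) = x ^+ k * (x ^+ a.-1) ^+ k.
  by rewrite -exprM -exprD; congr (_ ^+ _); rewrite mulnC -{1}(prednK a0) mulSn.
apply: ler_pM => //; first by rewrite !exprn_ge0 // ltW.
  rewrite (le_trans (ltW qgt)) // -?natrX ler_nat.
  have q8 : (8 <= q)%N by rewrite (leq_trans _ Qq) // leq_addl.
  rewrite expnS expn1 (@leq_trans (2 * q)) ?leq_mul2r ?(leq_trans _ q8) ?orbT //.
  by move: q8; move: (q) => q'; clear; lia.
by rewrite natrX lerXn2r ?nnegrE // exprn_ge0 // ltW.
Qed.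

(** A maximiser of [inner_pairs e S / x S ^+ m], with denominators cleared. *)
Lemma densest_set (R : realType) (V : finType) (e : rel V) (x : {set V} -> R) m :
  (forall S : {set V}, S != finset.set0 -> 0 < x S) -> (0 < #|V|)%N ->
  exists S : {set V}, [/\ S != finset.set0,
    (inner_pairs e [set: V]%SET)%:R * x S ^+ m <= (inner_pairs e S)%:R * x [set: V]%SET ^+ m
    & forall S' : {set V}, S' != finset.set0 ->
    (inner_pairs e S')%:R * x S ^+ m <= (inner_pairs e S)%:R * x S' ^+ m].
Proof.
move=> x_gt0 /card_gt0P[v _].
have T0 : [set: V]%SET != finset.set0 by apply/set0Pn; exists v; rewrite inE.
have [S S0 Smax] := @Order.TotalTheory.arg_maxP _ _ _ [set: V]%SET
  (fun S => S != finset.set0) (fun S => (inner_pairs e S)%:R / x S ^+ m : R) T0.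
have le S' : S' != finset.set0 ->
    (inner_pairs e S')%:R * x S ^+ m <= (inner_pairs e S)%:R * x S' ^+ m.
  move=> S'0; have /= := Smax S' S'0.
  by rewrite ler_pdivrMr ?exprn_gt0 ?x_gt0 // mulrAC ler_pdivlMr ?exprn_gt0 ?x_gt0.
by exists S; split=> //; apply: le.
Qed.

(** With [K = k * a] and [m = K + a.-1], [x S ^+ m] is [#|S|] to the power [1 + 1/k - 1/K]. If the
    pairs of the whole graph exceed [C] times this power, so do those of a densest set, which
    contains an almost regular core. *)
Lemma dense_graph_clique (R : realType) t k : (2 <= k)%N -> ~~ odd k ->
  exists K (C : R), [/\ (0 < K)%N, 0 < C & forall (V : finType) (e : rel V),
    symmetric e -> irreflexive e ->
    (exists b P, subdivided_clique e k./2 t b P) \/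
    (inner_pairs e [set: V]%SET)%:R <= C * #|V|%:R `^ (1 + k%:R^-1 - K%:R^-1)].
Proof.
move=> k2 kev; set l := k./2.
have kl : (l + l)%N = k by rewrite addnn /l -[RHS]odd_double_half (negbTE kev).
have l0 : (0 < l)%N by rewrite /l half_gt0.
have [B core] := subdivided_clique_regular t l0.
pose a := (2 * k * B.+1).+1; pose K := (k * a)%N.
(* [q] will be at least [Q]: the first summand serves [regular_graph], the second the sparsity of
   small sets. *)
pose Q := (B.+1 + 3 * 12 ^ K)%N.
pose C : R := ((Q + 8) ^ K)%:R.
have k0 : (0 < k)%N by apply: ltnW.
have K0 : (0 < K)%N by rewrite /K muln_gt0 k0.
have C0 : 0 < C by rewrite ltr0n expn_gt0 addn_gt0 orbT.
exists K, C; split=> // V e e_sym e_irr.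
have [V0|V0] := posnP #|V|.
  right; have -> : inner_pairs e [set: V]%SET = 0%N.
    apply/eqP; rewrite -leqn0 (leq_trans (inner_pairs_le _ _)) //.
    by rewrite cardsT V0.
  by rewrite mulr_ge0 ?powR_ge0 // ltW.
pose x (S : {set V}) : R := #|S|%:R `^ K%:R^-1.
have xK (S : {set V}) : x S ^+ K = #|S|%:R.
  by rewrite -powR_mulrn ?powR_ge0 // -powRrM mulVf ?pnatr_eq0 -?lt0n // powRr1.
have x0 S : S != finset.set0 -> 0 < x S.
  by move=> S0; rewrite powR_gt0 // ltr0n card_gt0.
pose m := (K + a.-1)%N.
have xm : x [set: V]%SET ^+ m = #|V|%:R `^ (1 + k%:R^-1 - K%:R^-1).
  rewrite -powR_mulrn ?powR_ge0 // -powRrM cardsT; congr (_ `^ _).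
  rewrite /m natrD mulrDr mulVf ?pnatr_eq0 -?lt0n // -addrA; congr (_ + _).
  have -> : a.-1%:R = a%:R - 1 :> R by rewrite -[in RHS]natr1 addrK.
  by rewrite mulrBr mulr1 /K natrM invfM -mulrA mulVf ?mulr1 // pnatr_eq0.
rewrite -xm; have [le|gt] := leP (inner_pairs e [set: V]%SET)%:R (C * x [set: V]%SET ^+ m).
  by right.
left; have [S [S0 Sdense Smax]] := @densest_set R V e x m x0 V0.
have s0 : (0 < #|S|)%N by rewrite card_gt0.
have x1 : 1 <= x S.
  have h : 1 <= x S ^+ K by rewrite xK ler1n.
  rewrite leNgt; apply/negP => lt; move: h; rewrite leNgt => /negP; apply.
  by rewrite exprn_ilt1 ?powR_ge0 // -lt0n.
have Cgt : C * x S ^+ m < (inner_pairs e S)%:R.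
  have T0 : [set: V]%SET != finset.set0 by rewrite -card_gt0 cardsT.
  rewrite -(ltr_pM2r (_ : 0 < x [set: V]%SET ^+ m)) ?exprn_gt0 ?x0 //.
  apply: lt_le_trans Sdense; rewrite mulrAC ltr_pM2r ?exprn_gt0 ?x0 //.
have := @densest_numerics R k a B Q #|S| (inner_pairs e S) (x S) C k2 erefl s0 x1
  (xK S) erefl Cgt (inner_pairs_le e S).
set q := Num.truncn _; cbv zeta => -[Qq qs d0 qd sd].
(* By maximality [S'] has at most the share [(x S' / x S) ^+ m] of the pairs. The exponent [K]
   contributes at most [3 / q], and [a.-1] at most [1 / 12], because [3 * 12 ^ K <= q]. *)
have sparse (S' : {set V}) : (#|S'| * q <= 3 * #|S| -> 4 * q * inner_pairs e S' <= inner_pairs e S)%N.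
  have [->|S'0] := eqVneq S' finset.set0.
    by rewrite {1}/inner_pairs big_set0 muln0.
  move=> S'q; have le := Smax S' S'0.
  have Sm0 : 0 < x S ^+ m by rewrite exprn_gt0 // x0.
  have y0 := x0 _ S'0; have xS0 := x0 _ S0.
  have yq : x S' ^+ K * q%:R <= 3 * x S ^+ K by rewrite !xK -!natrM ler_nat.
  have q12 : 3 * 12 ^+ K <= q%:R :> R.
    rewrite -natrX -natrM ler_nat (leq_trans _ Qq) // /Q leq_addl //.
  have y12 : 12 * x S' <= x S.
    rewrite -(ler_pXn2r K0) ?nnegrE ?mulr_ge0 ?(ltW y0) ?(ltW xS0) // exprMn.
    rewrite -(ler_pM2l (_ : 0 < 3)) // mulrA (le_trans _ yq) // [leRHS]mulrC.
    by rewrite ler_wpM2r // exprn_ge0 // ltW.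
  have ya : 12 * x S' ^+ a.-1 <= x S ^+ a.-1.
    apply: (@le_trans _ _ ((12 * x S') ^+ a.-1)).
      by rewrite exprMn ler_wpM2r ?exprn_ge0 ?(ltW y0) // ler_eXnr ?ler1n // /a /= !muln_gt0 k0.
    by rewrite lerXn2r ?nnegrE ?mulr_ge0 ?(ltW y0) ?(ltW xS0).
  rewrite -(ler_nat R) -(ler_pM2r Sm0) !natrM -mulrA.
  apply: (@le_trans _ _ (4 * q%:R * ((inner_pairs e S)%:R * x S' ^+ m))).
    by rewrite ler_wpM2l // mulr_ge0.
  rewrite mulrCA ler_wpM2l // /m !exprD.
  apply: (@le_trans _ _ (4 * (3 * x S ^+ K) * x S' ^+ a.-1)).
    have -> : 4 * q%:R * (x S' ^+ K * x S' ^+ a.-1) = 4 * (x S' ^+ K * q%:R) * x S' ^+ a.-1.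
      by ring.
    by rewrite ler_wpM2r ?exprn_ge0 ?(ltW y0) // ler_wpM2l.
  have -> : 4 * (3 * x S ^+ K) * x S' ^+ a.-1 = x S ^+ K * (12 * x S' ^+ a.-1).
    by ring.
  by rewrite ler_wpM2l // exprn_ge0 // ltW.
have [|U [US U0 Udeg]] := almost_regular_core e_sym qs _ sparse.
  by move: d0; case: (inner_pairs e S) => //; rewrite div0n.
apply: (clique_from_core (B := B.+1) (S := S) (U := U) (q := q)) => //.
- move=> T eT y0 q' d D sT iT reg; apply: (core T eT y0 q' d D) => //.
  by case: reg => [h1 h2 h3 h4 h5]; apply: (regular_graph_le (B := B.+1)) => //; apply: leq_trans h1.
- by rewrite (leq_trans _ Qq) // /Q leq_addr.
- rewrite (leq_trans _ Qq) // (leq_trans _ (leq_addl _ _)) //.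
  by apply: (@leq_trans (3 * 12 ^ 1)) => //; rewrite leq_mul2l leq_pexp2l.
by rewrite kl.
Qed.

Theorem theorem1p7 (R : realType) (V : finType) (F : sgraph V) (k : nat)
    (k_ge2 : (2 <= k)%N) (k_even : ~~ odd k) :
  exists eps : R, 0 < eps /\
    (fun n : nat => (extremal_number n (subdivision F k.-1))%:R : R) =O_\oo
      (fun n : nat => n%:R `^ (1 + k%:R^-1 - eps)).
Proof.
have [K [C [K0 C0 bound]]] := @dense_graph_clique R #|V| k k_ge2 k_even.
exists K%:R^-1; split; first by rewrite invr_gt0 ltr0n.
apply/eqO_exP; exists C => //; near=> n.
rewrite ger0_norm // ger0_norm ?powR_ge0 //.
set z := C * _; have z0 : 0 <= z by rewrite mulr_ge0 ?powR_ge0 // ltW.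
(* Truncating the real bound allows the maximum of natural numbers to be bounded graph by graph. *)
rewrite -truncn_ge_nat //; apply/bigmax_leqP => G free; rewrite truncn_ge_nat //.
have kl : k = (k./2 + k./2)%N by rewrite addnn -[LHS]odd_double_half (negbTE k_even).
have [[b [P clique]]|le] := bound 'I_n (adj G) (adj_sym G) (adj_irr G).
  by rewrite (subdivided_clique_copy F (ltnW k_ge2) kl clique) in free.
rewrite (le_trans _ (le_trans le _)) ?ler_nat ?card_edges_le //.
by rewrite card_ord.
Unshelve. all: by end_near.
Qed.
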